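(* Let $(V,\mathcal{Q},Z,\mathbf{G})$ be a Voronoi space and let $Q\in\mathcal{Q}$. (i) $Q$ is strictly extreme (a strict local maximum of the Hermite function $\gamma$ on $\mathcal{Q}$) if and only if $(Q,Q_{\min})$ is perfect and eutactic. (ii) $Q$ is extreme (a local maximum of $\gamma$ on $\mathcal{Q}$) if and only if there exists a nonempty subset $X\subseteq Q_{\min}$ such that $(Q,X)$ is weakly perfect and eutactic.
   Context: A Voronoi space $(V,\mathcal{Q},Z,\mathbf{G})$ consists of: a finite-dimensional real vector space $V$; a connected submanifold $\mathcal{Q}$ of the open cone of positive definite quadratic forms on $V$; a closed discrete subset $Z\subseteq V$ with $0\notin Z$ which spans $V$; a closed linear Lie group $\mathbf{G}<\mathrm{GL}(V)$; such that (i) if $Q\in\mathcal{Q}$, $c>0$ and $cQ\in\mathcal{Q}$ then $c=1$; (ii) for all $g\in\mathbf{G}$, $Q\in\mathcal{Q}$, the $Q$-adjoint $g^*_Q$ (defined by $Q(x,gy)=Q(g^*_Qx,y)$) lies in $\mathbf{G}$; (iii) for all $g\in\mathbf{G}$, $Q\in\mathcal{Q}$, $Q\circ g\in\mathcal{Q}$, and $\mathbf{G}$ acts transitively on $\mathcal{Q}$. A quadratic form and its symmetric bilinear form are denoted by the same letter, $Q(x)=Q(x,x)$. Let $\mathfrak{g}$ be the Lie algebra of $\mathbf{G}$. The Hermite function is $\gamma(Q)=\min_{x\in Z}Q(x)$, and $Q_{\min}=\{x\in Z: Q(x)=\gamma(Q)\}$. For $Q\in\mathcal{Q}$ and a nonempty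 finite $X\subseteq V\setminus\{0\}$: $(Q,X)$ is eutactic if for every $H\in\mathfrak{g}$, the existence of $x\in X$ with $Q(x,Hx)>0$ implies the existence of $y\in X$ with $Q(y,Hy)<0$; $(Q,X)$ is weakly perfect if for every $H\in\mathfrak{g}$ and $c\in\mathbb{R}$ with $Q(x,Hx)=cQ(x)$ for all $x\in X$, we have $Hx+H^*_Qx=2cx$ for all $x\in X$; $(Q,X)$ is perfect if for every $H\in\mathfrak{g}$ and $c\in\mathbb{R}$ with $Q(x,Hx)=cQ(x)$ for all $x\in X$, we have $H+H^*_Q=2c\,\mathrm{id}_V$. *)

(* Defs.v *)
From HB Require Import structures.
From mathcomp Require Import all_boot all_order all_algebra.
From mathcomp Require Import all_classical all_reals all_analysis.
Set Implicit Arguments.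
Unset Strict Implicit.
Unset Printing Implicit Defensive.
Import Order.TTheory GRing.Theory Num.Theory.
Import numFieldNormedType.Exports.
Local Open Scope classical_set_scope.
Local Open Scope ring_scope.

(* The finite-dimensional real vector space V is 'cV[R]_n, endomorphisms of V
   are n x n matrices, and a quadratic form on V is given by its symmetric
   Gram matrix; all of these carry the standard topology. *)

Section QuadraticForms.
Variables (R : realType) (n : nat).
Implicit Types (Q g h : 'M[R]_n) (x y : 'cV[R]_n).

Definition bform Q x y : R := (x^T *m Q *m y) 0 0.

Definition qform Q x : R := bform Q x x.

Definition posdef : set 'M[R]_n :=
  [set Q | Q^T = Q /\ forall x, x != 0 -> 0 < qform Q x].

(* Gram matrix of the form x |-> Q (g x). *)
Definition pullback Q g : 'M[R]_n := g^T *m Q *m g.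

Lemma bform_pullback Q g x y :
  bform (pullback Q g) x y = bform Q (g *m x) (g *m y).
Proof. by rewrite /bform /pullback trmx_mul !mulmxA. Qed.

Definition is_adjoint Q g h :=
  forall x y, bform Q x (g *m y) = bform Q (h *m x) y.

Definition adjoint Q g : 'M[R]_n := xget 0 [set h | is_adjoint Q g h].

End QuadraticForms.

Section AdjointTheory.
Variables (R : realType) (n : nat).
Implicit Types (Q g h : 'M[R]_n) (x y : 'cV[R]_n).

Lemma bform_inj (A B : 'M[R]_n) :
  (forall x y, bform A x y = bform B x y) -> A = B.
Proof.
move=> AB; apply/matrixP => i j.
have := AB (delta_mx i 0) (delta_mx j 0).
by rewrite /bform !trmx_delta -!rowE -!colE !mxE.
Qed.

Lemma posdef_unitmx Q : posdef Q -> Q \in unitmx.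
Proof.
move=> [_ Qpos]; rewrite -unitmx_tr -row_free_unit -kermx_eq0.
apply/negPn/negP => /rowV0Pn[v /sub_kermxP vQ v0].
have := Qpos v^T; rewrite /qform /bform trmxK -mulmxA.
have -> : Q *m v^T = 0 by rewrite -[RHS]trmx0 -vQ trmx_mul trmxK.
rewrite mulmx0 mxE ltxx; suff -> : v^T != 0 by move=> /(_ isT).
by rewrite -trmx0 (inj_eq trmx_inj).
Qed.

Lemma is_adjointE Q g h :
  posdef Q -> is_adjoint Q g h <-> h = invmx Q *m g^T *m Q.
Proof.
move=> Qpd; have Qu := posdef_unitmx Qpd; have [Qsym _] := Qpd.
have -> : is_adjoint Q g h <-> Q *m g = h^T *m Q.
  split=> [adj|E x y].
    by apply: bform_inj => x y; have := adj x y;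
      rewrite /bform trmx_mul !mulmxA.
  by rewrite /bform trmx_mul !mulmxA -(mulmxA _ Q g) E !mulmxA.
split=> [E | ->].
  by rewrite -mulmxA -{2}Qsym -trmx_mul E trmx_mul trmxK Qsym mulKmx.
by rewrite !trmx_mul trmxK trmx_inv Qsym -!mulmxA mulVmx // mulmx1.
Qed.

Lemma adjointE Q g : posdef Q -> adjoint Q g = invmx Q *m g^T *m Q.
Proof.
move=> Qpd; apply/(is_adjointE g _ Qpd); rewrite /adjoint.
by apply: (xgetPex 0); exists (invmx Q *m g^T *m Q); apply/(is_adjointE g _ Qpd).
Qed.

End AdjointTheory.

Section Smooth.
Variables (R : realType) (E F : normedModType R).

(* For E of finite dimension and A open, this is f \in C^k(A): a function is
   C^(k+1) iff it is differentiable and all its directional derivatives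
   are C^k. *)
Fixpoint Ck (k : nat) (A : set E) (f : E -> F) : Prop :=
  match k with
  | 0 => forall x, A x -> {for x, continuous f}
  | k'.+1 => (forall x, A x -> differentiable f x) /\
             (forall v : E, Ck k' A (fun x => 'D_v f x))
  end.

Definition smooth_on (A : set E) (f : E -> F) : Prop := forall k, Ck k A f.

End Smooth.

Section Submanifold.
Variables (R : realType) (n : nat).

Record diffeomorphism (U U' : set 'M[R]_n) (phi psi : 'M[R]_n -> 'M[R]_n) :
    Prop := Diffeomorphism {
  diffeo_open : open U ;
  diffeo_open' : open U' ;
  diffeo_fun : forall x, U x -> U' (phi x) ;
  diffeo_inv : forall y, U' y -> U (psi y) ;
  diffeo_can : forall x, U x -> psi (phi x) = x ;
  diffeo_can' : forall y, U' y -> phi (psi y) = y ;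
  diffeo_smooth : smooth_on U phi ;
  diffeo_smooth' : smooth_on U' psi }.

(* Embedded smooth submanifold, by local charts of the ambient space that
   straighten M onto an open piece of a linear subspace W. Symmetric matrices
   form a linear subspace in which posdef is open, so for M `<=` posdef being a
   submanifold of posdef is the same as being a submanifold of 'M[R]_n. *)
Definition submanifold (M : set 'M[R]_n) : Prop :=
  forall P, M P ->
    exists (U U' : set 'M[R]_n) (phi psi : 'M[R]_n -> 'M[R]_n)
           (W : {vspace 'M[R]_n}),
      [/\ U P, diffeomorphism U U' phi psi &
          phi @` (M `&` U) = U' `&` [set A | A \in W]].

End Submanifold.

Section LieGroup.
Variables (R : realType) (n : nat).

(* Closedness is relative to GL(V), not to the space of all matrices. *)
Record closed_linear_group (G : set 'M[R]_n) : Prop := ClosedLinearGroup {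
  clg_unit : forall g, G g -> g \in unitmx ;
  clg_one : G 1%:M ;
  clg_mul : forall g h, G g -> G h -> G (g *m h) ;
  clg_inv : forall g, G g -> G (invmx g) ;
  clg_closed : forall g, g \in unitmx -> closure G g -> G g }.

Definition expmx (A : 'M[R]_n) : 'M[R]_n :=
  lim (series (fun k => (k`!%:R)^-1 *: A ^+ k) @ \oo).

Definition lie_algebra (G : set 'M[R]_n) : set 'M[R]_n :=
  [set H | forall t : R, G (expmx (t *: H))].

End LieGroup.

Section Voronoi.
Variables (R : realType) (n : nat).
Implicit Types (QQ G : set 'M[R]_n) (Q P g H : 'M[R]_n).
Implicit Types (Z X : set 'cV[R]_n).

Record voronoi_space QQ Z G : Prop := VoronoiSpace {
  vs_posdef : QQ `<=` @posdef R n ;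
  vs_submanifold : submanifold QQ ;
  vs_connected : connected QQ ;
  vs_closed : closed Z ;
  vs_discrete : Z `<=` isolated Z ;
  vs_neq0 : ~ Z 0 ;
  vs_span : forall v, exists2 s : seq 'cV[R]_n,
    (forall x, x \in s -> Z x) & v \in span s ;
  vs_group : closed_linear_group G ;
  vs_scale : forall Q (c : R), QQ Q -> 0 < c -> QQ (c *: Q) -> c = 1 ;
  vs_adjoint : forall g Q, G g -> QQ Q -> G (adjoint Q g) ;
  vs_act : forall g Q, G g -> QQ Q -> QQ (pullback Q g) ;
  vs_trans : forall Q P, QQ Q -> QQ P -> exists2 g, G g & P = pullback Q g }.

(* The value 0 is returned only if there is no minimum, which does not happen
   for Q positive definite and Z nonempty, closed and discrete. *)
Definition hermite Z Q : R :=
  xget 0 [set m | (qform Q @` Z) m /\ lbound (qform Q @` Z) m].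

Definition Qmin Z Q : set 'cV[R]_n := [set x | Z x /\ qform Q x = hermite Z Q].

Definition extreme QQ Z Q : Prop :=
  \forall P \near Q, QQ P -> hermite Z P <= hermite Z Q.

Definition strictly_extreme QQ Z Q : Prop :=
  \forall P \near Q, QQ P -> P != Q -> hermite Z P < hermite Z Q.

(* The next three notions are meant for X nonempty, finite and without 0. *)
Definition eutactic G Q X : Prop :=
  forall H, lie_algebra G H ->
    (exists2 x, X x & 0 < bform Q x (H *m x)) ->
    exists2 y, X y & bform Q y (H *m y) < 0.

Definition weakly_perfect G Q X : Prop :=
  forall H (c : R), lie_algebra G H ->
    (forall x, X x -> bform Q x (H *m x) = c * qform Q x) ->
    forall x, X x -> H *m x + adjoint Q H *m x = (2 * c) *: x.

Definition perfect G Q X : Prop :=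
  forall H (c : R), lie_algebra G H ->
    (forall x, X x -> bform Q x (H *m x) = c * qform Q x) ->
    H + adjoint Q H = (2 * c)%:M.

End Voronoi.

(* Main.v *)
Require Import Defs.
From HB Require Import structures.
From mathcomp Require Import all_boot all_order all_algebra.
From mathcomp Require Import all_classical all_reals all_analysis.
From mathcomp Require Import ring lra.
Import Order.TTheory GRing.Theory Num.Theory.
Import numFieldNormedType.Exports.
Local Open Scope classical_set_scope.
Local Open Scope ring_scope.
Set Implicit Arguments.
Unset Strict Implicit.
Unset Printing Implicit Defensive.

(** Put [P = Q p] for [P] in the orbit of [Q]; then [p = g^* g] is a [Q]-self-adjoint element of
    [G].  Since [G] is closed, every limit of directions [(q - 1) / |q - 1|], with [q] in [G]
    tending to [1], lies in the Lie algebra.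

    Sufficiency.  If [gamma] failed to have a local maximum at [Q], such a limit direction [D]
    would satisfy [Q(x, D x) >= 0] on the minimal vectors, hence [= 0] by eutaxy, and (weak)
    perfection would give [D = 0], resp. [D x = 0] on [X].  In the weak case, [q] is first moved
    as close to [1] as possible by elements of [G] fixing [X] pointwise, and [exp(- t D)] is
    such an element moving it still closer.

    Necessity.  For self-adjoint [K] in the Lie algebra, [t |-> Q(exp(t K) x)] is convex, so
    [Q(x, K x) >= 0] on the minimal vectors forces [gamma] not to decrease along [exp(t K)].
    In the weak case, [X] is a minimal set of minimal vectors that are killed by arbitrarily
    small [K] strictly increasing [Q] on all the other minimal vectors. *)

(** Puts completeness and the norm on one structure, so that [normed_cvg] applies to series of
    matrices. *)
HB.instance Definition _ (R : realType) (m n : nat) := Complete.on 'M[R]_(m, n).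

(** * Estimates and limits in the entrywise maximum norm *)

Section MatrixNorm.
Variable R : realType.

Lemma mx_norm_leP (m n : nat) (A : 'M[R]_(m, n)) (c : R) : 0 <= c ->
  `|A| <= c <-> forall i j, `|A i j| <= c.
Proof.
move=> c0; rewrite {1}/Num.norm /= mx_normrE; split.
  by move=> + i j; apply: le_trans; exact: (le_bigmax _ _ (i, j)).
by move=> Ac; apply: bigmax_le => //= ij _; exact: Ac.
Qed.

Lemma le_coord_mx_norm (m n : nat) (A : 'M[R]_(m, n)) i j : `|A i j| <= `|A|.
Proof. by move: i j; apply/mx_norm_leP. Qed.

(** The norm is the largest absolute value of an entry, hence submultiplicative only up to the
    number [n] of terms in an entry of the product. This factor recurs in the later constants. *)
Lemma mx_normM (m n p : nat) (A : 'M[R]_(m, n)) (B : 'M[R]_(n, p)) :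
  `|A *m B| <= n%:R * `|A| * `|B|.
Proof.
apply/mx_norm_leP => [|i j]; first by rewrite !mulr_ge0.
rewrite mxE (le_trans (ler_norm_sum _ _ _))//.
have -> : n%:R * `|A| * `|B| = \sum_(k < n) `|A| * `|B|.
  by rewrite sumr_const card_ord -mulrA mulr_natl.
apply: ler_sum => k _.
by rewrite normrM ler_pM// le_coord_mx_norm.
Qed.

Lemma mx_norm_tr (m n : nat) (A : 'M[R]_(m, n)) : `|A^T| = `|A|.
Proof.
have le_tr p q (B : 'M[R]_(p, q)) : `|B^T| <= `|B|.
  by apply/mx_norm_leP => // i j; rewrite mxE le_coord_mx_norm.
by apply/eqP; rewrite eq_le le_tr -{1}[A]trmxK le_tr.
Qed.

Lemma mx_norm1 (n : nat) : `|1%:M : 'M[R]_n| <= 1.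
Proof.
apply/mx_norm_leP => // i j; rewrite mxE.
by case: (i == j); rewrite ?normr1 ?normr0.
Qed.

Lemma mx_normX (n : nat) (A : 'M[R]_n) k : `|A ^+ k| <= (n%:R * `|A|) ^+ k.
Proof.
elim: k => [|k IH]; first by rewrite !expr0 mx_norm1.
rewrite !exprS (le_trans (mx_normM _ _))// ler_wpM2l// mulr_ge0//.
Qed.

(** Telescoping: the difference at [k.+1] splits into [A (A^k - B^k)] and [(A - B) B^k]. For [k = 0]
    both sides vanish, so the truncated exponent [k.-1] is harmless. *)
Lemma mx_normBX (n : nat) (A B : 'M[R]_n) (c : R) k : `|A| <= c -> `|B| <= c ->
  `|A ^+ k - B ^+ k| <= k%:R * (n%:R * c) ^+ k.-1 * (n%:R * `|A - B|).
Proof.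
move=> Ac Bc; have c0 : 0 <= c := le_trans (normr_ge0 _) Ac.
have nc0 : 0 <= n%:R * c by rewrite mulr_ge0.
elim: k => [|k IH]; first by rewrite !expr0 subrr normr0 !mul0r.
have -> : A ^+ k.+1 - B ^+ k.+1 = A *m (A ^+ k - B ^+ k) + (A - B) *m B ^+ k.
  by rewrite !exprS mulmxBr mulmxBl addrA subrK.
rewrite (le_trans (ler_normD _ _))// -natr1 mulrDl mul1r mulrDl lerD//=.
  rewrite (le_trans (mx_normM _ _))//.
  rewrite (@le_trans _ _ (n%:R * c * `|A ^+ k - B ^+ k|))//.
    by rewrite ler_wpM2r// ler_wpM2l.
  rewrite (le_trans (ler_wpM2l nc0 IH))//.
  case: k {IH} => [|k]; first by rewrite !mul0r mulr0.
  by rewrite /= exprS !mulrA [_ * k.+1%:R]mulrC !mulrA.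
rewrite (le_trans (mx_normM _ _))// mulrC ler_wpM2r//.
rewrite (le_trans (mx_normX _ _))// lerXn2r ?nnegrE ?mulr_ge0//.
by rewrite ler_wpM2l.
Qed.

Lemma cvg_mx_norm_le (m n : nat) (u : nat -> 'M[R]_(m, n)) (l : 'M[R]_(m, n)) (c : R) :
  u @ \oo --> l -> (\forall k \near \oo, `|u k| <= c) -> `|l| <= c.
Proof.
move=> ul uc; have nul : `|u k| @[k --> \oo] --> `|l| by exact: cvg_norm.
by rewrite -(cvg_lim (@Rhausdorff R) nul); apply: limr_le => //; apply/cvg_ex; exists `|l|.
Qed.

Lemma cvg_mulmxl (T : Type) (F : set_system T) {FF : Filter F} (m n p : nat)
    (A : 'M[R]_(m, n)) (u : T -> 'M[R]_(n, p)) (l : 'M[R]_(n, p)) :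
  u @ F --> l -> (fun x => A *m u x) @ F --> A *m l.
Proof.
move=> ul; apply/cvgrPdist_le => e e0.
have c0 : 0 < n%:R * `|A| + 1 by rewrite ltr_wpDl// mulr_ge0.
near=> x; rewrite -mulmxBr (le_trans (mx_normM _ _))//.
rewrite (@le_trans _ _ ((n%:R * `|A| + 1) * `|l - u x|))//.
  by rewrite ler_wpM2r// lerDl.
rewrite mulrC -ler_pdivlMr//; near: x.
by apply: cvgr_dist_le => //; rewrite divr_gt0.
Unshelve. all: by end_near. Qed.

Lemma cvg_trmx (T : Type) (F : set_system T) {FF : Filter F} (m n : nat)
    (u : T -> 'M[R]_(m, n)) (l : 'M[R]_(m, n)) :
  u @ F --> l -> (fun x => (u x)^T) @ F --> l^T.
Proof.
move=> ul; apply/cvgrPdist_le => e e0; near=> x.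
rewrite -linearB mx_norm_tr; near: x; exact: cvgr_dist_le.
Unshelve. all: by end_near. Qed.

Lemma cvg_mulmxr (T : Type) (F : set_system T) {FF : Filter F} (m n p : nat)
    (A : 'M[R]_(n, p)) (u : T -> 'M[R]_(m, n)) (l : 'M[R]_(m, n)) :
  u @ F --> l -> (fun x => u x *m A) @ F --> l *m A.
Proof.
move=> /cvg_trmx ul.
have trE (B : 'M[R]_(m, n)) : B *m A = (A^T *m B^T)^T by rewrite trmx_mul !trmxK.
rewrite trE; under eq_fun do rewrite trE.
by apply: cvg_trmx; apply: cvg_mulmxl.
Qed.

End MatrixNorm.

(** * The matrix exponential: convergence, Taylor remainders, comparison with powers *)

Section MatrixExponential.
Variables (R : realType) (n : nat).
Implicit Types (A B H K : 'M[R]_n).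

Lemma series_exp_coeff_le (x : R) k : 0 <= x -> series (exp_coeff x) k <= expR x.
Proof.
move=> x0; apply: nondecreasing_cvgn_le; last exact: is_cvg_series_exp_coeff.
by apply/nondecreasing_seqP => m; rewrite /series/= big_nat_recr//= lerDl exp_coeff_ge0.
Qed.

Lemma is_cvg_dominated_series (u : nat -> 'M[R]_n) (v : nat -> R) (s : R) :
  (forall k, `|u k| <= v k) -> (forall k, series v k <= s) ->
  cvgn (series u) /\ `|lim (series u @ \oo)| <= s.
Proof.
move=> uv vs.
have cu : cvgn (series u).
  apply: normed_cvg; apply: nondecreasing_is_cvgn.
    by apply/nondecreasing_seqP => m; rewrite /= /series /= big_nat_recr//= lerDl.
  exists s => _ [k _ <-]; apply: le_trans (vs k).
  by rewrite /= /series /=; apply: ler_sum => i _; exact: uv.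
split=> //; apply: (cvg_mx_norm_le cu).
apply: nearW => k; apply: le_trans (vs k).
rewrite /series /= (le_trans (ler_norm_sum _ _ _))//.
by apply: ler_sum => i _; exact: uv.
Qed.

(** [expmx] is a [lim], so it can be used only once convergence is known; the scalar exponential
    series at [n |A|] dominates. *)
Lemma cvg_expmx A :
  series (fun k => (k`!%:R)^-1 *: A ^+ k) @ \oo --> expmx A.
Proof.
have [] := @is_cvg_dominated_series (fun k => (k`!%:R)^-1 *: A ^+ k)
  (exp_coeff (n%:R * `|A|)) (expR (n%:R * `|A|)) => [k|k|//].
  rewrite normrZ /exp_coeff/= mulrC ger0_norm// ler_wpM2r//; exact: mx_normX.
by apply: series_exp_coeff_le; rewrite mulr_ge0.
Qed.

Arguments cvg_expmx : clear implicits.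

(** By [mx_normBX] the term of index [k] carries [k / k! = 1 / (k - 1)!], so the differences are
    dominated by the scalar exponential series shifted by one. *)
Lemma expmx_lipschitz A B (c : R) : `|A| <= c -> `|B| <= c ->
  `|expmx A - expmx B| <= n%:R * expR (n%:R * c) * `|A - B|.
Proof.
move=> Ac Bc; have c0 : 0 <= c := le_trans (normr_ge0 _) Ac.
apply: (@cvg_mx_norm_le _ _ _ (fun k => series (fun k => (k`!%:R)^-1 *: A ^+ k) k
  - series (fun k => (k`!%:R)^-1 *: B ^+ k) k)).
  by apply: cvgB; exact: cvg_expmx.
apply: nearW => k; rewrite /series /= -sumrB (le_trans (ler_norm_sum _ _ _))//.
rewrite -mulrA mulrCA.
apply: (@le_trans _ _ (series (exp_coeff (n%:R * c)) k.-1 * (n%:R * `|A - B|))); last first.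
  by rewrite ler_wpM2r ?mulr_ge0// series_exp_coeff_le// mulr_ge0.
case: k => [|k]; first by rewrite big_geq// mulr_ge0 ?mulr_ge0// /series /= big_geq.
rewrite big_nat_recl//= !expr0 subrr normr0 add0r /series /= mulr_suml.
apply: ler_sum => i _.
rewrite -scalerBr normrZ ger0_norm//.
rewrite (le_trans (ler_wpM2l _ (mx_normBX i.+1 Ac Bc)))//=.
rewrite !mulrA /exp_coeff/= ler_wpM2r// ler_wpM2r//.
by rewrite factS natrM invfM [X in X * _]mulrAC mulVf ?pnatr_eq0// mul1r mulrC.
Qed.

Lemma expmx_continuous : continuous (@expmx R n).
Proof.
move=> A; apply/(@cvgrPdist_le _ _ _ (nbhs A)) => e e0.
have d0 : 0 < n%:R * expR (n%:R * (`|A| + 1)) + 1 :> R.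
  by rewrite ltr_wpDl// mulr_ge0// expR_ge0.
near=> B.
have AB : `|A - B| <= Num.min 1 (e / (n%:R * expR (n%:R * (`|A| + 1)) + 1)).
  near: B; apply: cvgr_dist_le; first exact: cvg_id.
  by rewrite lt_min ltr01 divr_gt0.
move: AB; rewrite le_min => /andP[AB1 ABe].
have Bc : `|B| <= `|A| + 1.
  by rewrite -(subrK A B) addrC (le_trans (ler_normD _ _))// lerD2l distrC.
rewrite (le_trans (@expmx_lipschitz _ _ (`|A| + 1) _ Bc)) ?lerDl//.
move: ABe; rewrite ler_pdivlMr//; apply: le_trans.
by rewrite mulrC ler_wpM2l// lerDl.
Unshelve. all: by end_near. Qed.

(** The remainder has a factor [A] on each side: the right one makes it vanish on the kernel of [A],
    the left one can be moved across the bilinear form when [A] is self-adjoint. *)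
Lemma expmx_taylor2 A : exists2 B : 'M[R]_n,
  expmx A = 1%:M + A + 2^-1 *: (A *m A) + A *m B *m A &
  `|B| <= n%:R * `|A| * expR (n%:R * `|A|).
Proof.
set a := n%:R * `|A|; have a0 : 0 <= a by rewrite mulr_ge0.
pose u k := ((k.+3)`!%:R)^-1 *: A ^+ k.+1.
have [||cu ule] := @is_cvg_dominated_series u (fun k => a * exp_coeff a k) (a * expR a).
- move=> k; rewrite normrZ ger0_norm// /exp_coeff/= mulrA -exprS mulrC.
  rewrite ler_pM//; first exact: mx_normX.
  by rewrite lef_pV2 ?posrE ?ltr0n ?fact_gt0// ler_nat leq_fact// !leqW.
- by move=> k; rewrite /series/= -mulr_sumr ler_wpM2l// (series_exp_coeff_le k a0).
exists (lim (series u @ \oo)) => //.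
apply: (cvg_lim (@norm_hausdorff _ _)).
rewrite -(cvg_shiftn 3) /=.
rewrite (_ : (fun k => _) = fun k => 1%:M + A + 2^-1 *: (A *m A) + A *m series u k *m A).
  apply: cvgD; first exact: cvg_cst.
  by apply: cvg_mulmxr; apply: cvg_mulmxl.
apply/funext => k; rewrite /series /= addn3 !big_nat_recl//= expr0 expr1.
rewrite fact0 invr1 !scale1r !factS fact0 !mul1n muln1 !addrA expr2 mulmxE.
congr (_ + _); rewrite mulr_sumr mulr_suml; apply: eq_bigr => i _.
by rewrite /u -!mulmxE -scalemxAr -scalemxAl !mulmxE -exprS -exprSr.
Qed.

Lemma expmx_taylor1 : exists2 c : R, 0 < c &
  forall K, `|K| <= 1 -> `|expmx K - 1%:M - K| <= c * `|K| ^+ 2.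
Proof.
exists (n%:R + n%:R ^+ 3 * expR n%:R + 1) => [|K K1].
  by rewrite ltr_wpDl// addr_ge0// mulr_ge0// ?exprn_ge0// expR_ge0.
have [B -> Ble] := expmx_taylor2 K.
have -> : 1%:M + K + 2^-1 *: (K *m K) + K *m B *m K - 1%:M - K =
    2^-1 *: (K *m K) + K *m B *m K.
  by rewrite -[LHS]addrA -opprD -[1%:M + K + _ + _]addrA addrAC subrr add0r.
have k0 : 0 <= `|K| by [].
have e0 : 0 <= expR n%:R :> R by exact: expR_ge0.
have n0 : 0 <= n%:R :> R by [].
have BleE : `|B| <= n%:R * expR n%:R.
  apply: le_trans Ble _; rewrite ler_pM ?mulr_ge0 ?expR_ge0//.
    by rewrite ler_piMr.
  by rewrite ler_expR ler_piMr.
have KK : `|2^-1 *: (K *m K)| <= n%:R * `|K| ^+ 2.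
  rewrite normrZ ger0_norm// expr2 mulrA (le_trans _ (mx_normM K K))//.
  by rewrite ler_piMl// invf_le1// ler1n.
have KBK : `|K *m B *m K| <= n%:R ^+ 3 * expR n%:R * `|K| ^+ 2.
  rewrite (le_trans (mx_normM _ _))//.
  apply: (@le_trans _ _ (n%:R * (n%:R * `|K| * (n%:R * expR n%:R)) * `|K|)).
    rewrite ler_wpM2r// ler_wpM2l// (le_trans (mx_normM _ _))//.
    by rewrite ler_wpM2l// mulr_ge0.
  by rewrite le_eqVlt; apply/orP; left; apply/eqP; ring.
rewrite (le_trans (ler_normD _ _))// (le_trans (lerD KK KBK))//.
by rewrite -mulrDl ler_wpM2r ?exprn_ge0// lerDl.
Qed.

(** Padding with zero binomial coefficients gives the sum the same range as a partial sum of the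
    exponential series. *)
Lemma exprD1n_wide (S : pzSemiRingType) (x : S) m k : (m < k)%N ->
  (x + 1) ^+ m = \sum_(0 <= i < k) x ^+ i *+ 'C(m, i).
Proof.
move=> mk; rewrite exprD1n (big_cat_nat (leq0n _) mk)/= big_mkord.
rewrite [X in _ = _ + X]big_nat [X in _ = _ + X]big1 ?addr0// => i /andP[mi _].
by rewrite bin_small.
Qed.

Lemma ffact_le_expn m i : (m ^_ i <= m ^ i)%N.
Proof.
elim: i => [|i IH]; first by rewrite ffactn0.
by rewrite ffactnSr expnSr leq_mul// leq_subr.
Qed.

Lemma exprZmx (c : R) A k : (c *: A) ^+ k = c ^+ k *: A ^+ k.
Proof.
elim: k => [|k IH]; first by rewrite !expr0 scale1r.
by rewrite !exprS IH -!mulmxE -scalemxAl -scalemxAr scalerA.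
Qed.

(** With [E = expR b], telescoping reduces the claim to [E - (1 + b) <= b ^+ 2 * E], which is
    [1 - b <= E^-1] multiplied by [(1 + b) E]. *)
Lemma expR_sub_pow (b : R) m : 0 <= b ->
  expR (m%:R * b) - (1 + b) ^+ m <= m%:R * b ^+ 2 * expR (m%:R * b).
Proof.
move=> b0; rewrite expRM_natl; set E := expR b.
have E0 : 0 < E by exact: expR_gt0.
have FE : 1 + b <= E by exact: expR_ge1Dx.
have EF : E - (1 + b) <= b ^+ 2 * E.
  have : 1 - b <= E^-1 by rewrite -expRN expR_ge1Dx.
  rewrite -div1r ler_pdivlMr// => h.
  have : (1 - b) * E * (1 + b) <= 1 * (1 + b) by rewrite ler_wpM2r// addr_ge0.
  by rewrite expr2; lra.
elim: m => [|m IH]; first by rewrite !expr0 subrr !mul0r.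
have -> : E ^+ m.+1 - (1 + b) ^+ m.+1 =
    E * (E ^+ m - (1 + b) ^+ m) + (E - (1 + b)) * (1 + b) ^+ m.
  by rewrite !exprS; ring.
have -> : m.+1%:R * b ^+ 2 * E ^+ m.+1 =
    E * (m%:R * b ^+ 2 * E ^+ m) + b ^+ 2 * E * E ^+ m.
  by rewrite -natr1 [E ^+ m.+1]exprS; ring.
rewrite lerD// ?ler_pM2l// ler_pM ?subr_ge0//.
  by rewrite exprn_ge0// addr_ge0.
by rewrite lerXn2r// nnegrE ?addr_ge0// ltW.
Qed.

(* The coefficients of e^(mx) dominate those of (1 + x)^m, so the matrix
   difference is bounded by the scalar one. *)
Lemma expmx_sub_pow B m (b := n%:R * `|B|) :
  `|(1%:M + B) ^+ m - expmx (m%:R *: B)| <= m%:R * b ^+ 2 * expR (m%:R * b).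
Proof.
have b0 : 0 <= b by rewrite mulr_ge0.
apply: le_trans (expR_sub_pow m b0).
apply: (@cvg_mx_norm_le _ _ _ (fun k => (1%:M + B) ^+ m -
  series (fun k => (k`!%:R)^-1 *: (m%:R *: B) ^+ k) k)).
  by apply: cvgB; [exact: cvg_cst|exact: cvg_expmx].
near=> k; have mk : (m < k)%N by near: k; exact: nbhs_infty_gt.
rewrite [1%:M + B]addrC [1 + b]addrC !(exprD1n_wide _ mk) /series /= -sumrB.
rewrite (le_trans (ler_norm_sum _ _ _))//.
rewrite (@le_trans _ _ (series (exp_coeff (m%:R * b)) k -
  \sum_(0 <= i < k) b ^+ i *+ 'C(m, i)))//; last first.
  by rewrite lerB// series_exp_coeff_le// mulr_ge0.
rewrite /series /= -sumrB; apply: ler_sum => i _.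
have f0 : 0 < i`!%:R :> R by rewrite ltr0n fact_gt0.
have Cle : 'C(m, i)%:R <= m%:R ^+ i / i`!%:R :> R.
  by rewrite ler_pdivlMr// -natrM bin_ffact -natrX ler_nat ffact_le_expn.
rewrite exprZmx scalerA -[B ^+ i *+ _]scaler_nat -scalerBl normrZ distrC.
rewrite [_^-1 * _]mulrC ger0_norm ?subr_ge0// /exp_coeff /= exprMn mulrAC.
rewrite -[b ^+ i *+ _]mulr_natl -mulrBl ler_wpM2l ?subr_ge0//; exact: mx_normX.
Unshelve. all: by end_near. Qed.

End MatrixExponential.

(** * The Lie algebra as the tangent space of the group at [1] *)

Section LieAlgebraTheory.
Variables (R : realType) (n : nat).
Implicit Types (A B H K g : 'M[R]_n).

(** One pair [a], [g] for each [e] is enough: this is tangency along a sequence, which is what a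
    limit of directions yields. *)
Definition tangent (G : set 'M[R]_n) H := forall e : R, 0 < e ->
  exists a g, [/\ 0 < a < e, G g & `|g - 1%:M - a *: H| <= e * a].

(** Euler's limit: with [B = g - 1] and [m] the integer part of [t / a], the power [g ^+ m] is close
    to [expmx (m B)], and [m B] is close to [t H] because [m a] differs from [t] by at most [a]. *)
Lemma pow_near_expmx H (t e : R) : 0 <= t -> 0 < e ->
  exists2 d, 0 < d & forall a g, 0 < a < d -> `|g - 1%:M - a *: H| <= d * a ->
    `|g ^+ Num.truncn (t / a) - expmx (t *: H)| <= e.
Proof.
move=> t0 e0; pose h := `|H|; pose h1 := h + 1.
have h0 : 0 <= h := normr_ge0 _; have h10 : 0 <= h1 by rewrite addr_ge0.
have n0 : 0 <= n%:R :> R by [].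
pose E := expR (n%:R * (t * h1)); have E0 : 0 < E := expR_gt0 _.
(* The first summand is the error of replacing the power by an exponential ([step1]), the second
   that of replacing [m B] by [t H] ([step2]), each per unit of [d]. *)
pose C := t * (n%:R * h1) ^+ 2 * E + n%:R * E * (t + h).
have C0 : 0 <= C.
  by rewrite addr_ge0// !mulr_ge0// ?exprn_ge0 ?mulr_ge0 ?addr_ge0// ltW.
exists (Num.min 1 (e / (C + 1))) => [|a g].
  by rewrite lt_min ltr01 divr_gt0// ltr_wpDl.
set d := Num.min _ _ => /andP[a0 ad] gd.
have d1 : d <= 1 by rewrite ge_min lexx.
have de : d * (C + 1) <= e.
  by rewrite -ler_pdivlMr ?ltr_wpDl// ge_min lexx orbT.
have d0 : 0 < d := lt_trans a0 ad.
have ta0 : 0 <= t / a by rewrite divr_ge0// ltW.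
set m := Num.truncn _; pose B := g - 1%:M.
have /andP[mle mlt] : m%:R <= t / a < m.+1%:R by rewrite truncn_itv.
have mat : m%:R * a <= t by rewrite -ler_pdivlMr.
have mta : t - m%:R * a <= a.
  by move: mlt; rewrite ltr_pdivrMr// -natr1; lra.
have Ble : `|B| <= a * h1.
  rewrite -(subrK (a *: H) B) (le_trans (ler_normD _ _))//.
  rewrite normrZ gtr0_norm// /h1 mulrDr mulr1 addrC lerD2l (le_trans gd)//.
  by rewrite ler_piMl// ltW.
have {}gd : `|B - a *: H| <= d * a := gd.
have -> : g = 1%:M + B by rewrite addrC subrK.
clearbody B.
have m0 : 0 <= m%:R :> R by [].
have mBle : `|m%:R *: B| <= t * h1.
  rewrite normrZ ger0_norm// (le_trans (ler_wpM2l m0 Ble))// mulrA.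
  by rewrite ler_wpM2r.
have tHle : `|t *: H| <= t * h1.
  by rewrite normrZ ger0_norm// ler_wpM2l// lerDl.
have step1 : `|(1%:M + B) ^+ m - expmx (m%:R *: B)| <= d * (t * (n%:R * h1) ^+ 2 * E).
  apply: le_trans (expmx_sub_pow B m) _.
  have bE : expR (m%:R * (n%:R * `|B|)) <= E.
    rewrite ler_expR mulrCA ler_wpM2l//.
    by rewrite -[X in X * _](ger0_norm m0) -normrZ.
  rewrite [X in _ <= X]mulrA ler_pM// ?mulr_ge0 ?exprn_ge0 ?expR_ge0 ?mulr_ge0//.
  have b2 : (n%:R * `|B|) ^+ 2 <= (n%:R * (a * h1)) ^+ 2.
    by rewrite lerXn2r ?nnegrE ?mulr_ge0 ?(ltW a0)// ler_wpM2l.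
  rewrite (le_trans (ler_wpM2l m0 b2))//.
  have -> : m%:R * (n%:R * (a * h1)) ^+ 2 = (m%:R * a) * a * (n%:R * h1) ^+ 2.
    by ring.
  rewrite [X in _ <= X]mulrA ler_wpM2r ?exprn_ge0 ?mulr_ge0// [d * t]mulrC.
  by rewrite ler_pM ?mulr_ge0 ?(ltW a0) ?(ltW ad).
have step2 : `|expmx (m%:R *: B) - expmx (t *: H)| <= d * (n%:R * E * (t + h)).
  apply: le_trans (expmx_lipschitz mBle tHle) _.
  rewrite [d * _]mulrCA ler_wpM2l ?mulr_ge0 ?(ltW E0)//.
  have -> : m%:R *: B - t *: H = m%:R *: (B - a *: H) - (t - m%:R * a) *: H.
    by rewrite scalerBr scalerBl scalerA opprB addrA subrK.
  rewrite (le_trans (ler_normB _ _))// !normrZ mulrDr lerD//.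
    rewrite ger0_norm// (le_trans (ler_wpM2l m0 gd))// mulrCA.
    by rewrite ler_wpM2l// ltW.
  rewrite ger0_norm ?subr_ge0// ler_wpM2r//.
  by rewrite (le_trans mta)// ltW.
rewrite -(subrK (expmx (m%:R *: B)) ((1%:M + B) ^+ m)) -addrA.
rewrite (le_trans (ler_normD _ _))// (le_trans (lerD step1 step2))//.
by rewrite -mulrDr -/C (le_trans _ de)// ler_wpM2l ?lerDl// ltW.
Qed.

(** Needed to reach negative times. The error is [g^-1] times [a (g - 1) H - (g - 1 - a H)], and
    both terms are at most a constant times [d a]. *)
Lemma invmx_near H (e : R) : 0 < e ->
  exists2 d, 0 < d & forall a g, g \in unitmx -> 0 < a < d ->
    `|g - 1%:M - a *: H| <= d * a -> `|invmx g - 1%:M - a *: (- H)| <= e * a.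
Proof.
move=> e0; pose h := `|H|; pose h1 := h + 1.
have h0 : 0 <= h := normr_ge0 _; have h10 : 0 <= h1 by rewrite addr_ge0.
have n0 : 0 <= n%:R :> R by [].
pose C := 2 * n%:R * (1 + n%:R * h1 * h).
have C0 : 0 <= C by rewrite !mulr_ge0// addr_ge0// !mulr_ge0.
have n1 : 0 < 2 * (n%:R * h1 + 1) by rewrite mulr_gt0// ltr_wpDl// mulr_ge0.
exists (Num.min 1 (Num.min (2 * (n%:R * h1 + 1))^-1 (e / (C + 1)))) => [|a g gu].
  by rewrite !lt_min ltr01 divr_gt0// ?ltr_wpDl// invr_gt0 n1.
set d := Num.min _ _ => /andP[a0 ad] gd.
have [d1 [dn de]] : d <= 1 /\ d <= (2 * (n%:R * h1 + 1))^-1 /\ d <= e / (C + 1).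
  by rewrite !ge_min !lexx !orbT.
move: de; rewrite ler_pdivlMr ?ltr_wpDl// => de.
have a0' := ltW a0; have ad' := ltW ad.
have gle : `|g - 1%:M| <= a * h1.
  rewrite -(subrK (a *: H) (g - 1%:M)) (le_trans (ler_normD _ _))//.
  rewrite normrZ gtr0_norm// /h1 mulrDr mulr1 addrC lerD2l (le_trans gd)//.
  by rewrite ler_piMl.
have an : n%:R * (a * h1) <= 2^-1.
  have : a <= (2 * (n%:R * h1 + 1))^-1 by apply: le_trans dn.
  rewrite -div1r ler_pdivlMr//; nra.
(* Absorption: [g^-1 = 1 - g^-1 (g - 1)] bounds the norm of [g^-1] by [1] plus half of itself. *)
have ig : `|invmx g| <= 2.
  have : `|invmx g| <= 1 + `|invmx g| * 2^-1.
    have {1}-> : invmx g = 1%:M - invmx g *m (g - 1%:M).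
      by rewrite mulmxBr mulVmx// mulmx1 opprB addrC subrK.
    rewrite (le_trans (ler_normB _ _))// lerD// ?mx_norm1//.
    rewrite (le_trans (mx_normM _ _))// -mulrA mulrCA ler_wpM2l//.
    by rewrite (le_trans _ an)// ler_wpM2l.
  lra.
have -> : invmx g - 1%:M - a *: (- H) =
    invmx g *m ((a *: (g - 1%:M)) *m H - (g - 1%:M - a *: H)).
  have iH : invmx g *m ((a *: (g - 1%:M)) *m H) = a *: H - a *: (invmx g *m H).
    by rewrite -scalemxAl -scalemxAr mulmxA mulmxBr mulVmx// mulmx1 mulmxBl mul1mx scalerBr.
  have i1 : invmx g *m (g - 1%:M - a *: H) = 1%:M - invmx g - a *: (invmx g *m H).
    by rewrite !mulmxBr mulVmx// mulmx1 -scalemxAr.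
  by rewrite mulmxBr iH i1 scalerN opprK opprB addrA subrK opprB addrC.
rewrite (le_trans (mx_normM _ _))//.
have rle : `|(a *: (g - 1%:M)) *m H - (g - 1%:M - a *: H)| <= (1 + n%:R * h1 * h) * (d * a).
  rewrite (le_trans (ler_normB _ _))// addrC mulrDl mul1r lerD//.
  rewrite (le_trans (mx_normM _ _))// normrZ ger0_norm//.
  have : n%:R * (a * `|g - 1%:M|) <= n%:R * h1 * (d * a).
    have -> : n%:R * h1 * (d * a) = n%:R * (a * (d * h1)) by ring.
    rewrite ler_wpM2l// ler_wpM2l// (le_trans gle)// ler_wpM2r//.
  by move=> /(ler_wpM2r h0); rewrite [X in _ <= X]mulrAC.
apply: (@le_trans _ _ (n%:R * 2 * ((1 + n%:R * h1 * h) * (d * a)))).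
  by rewrite ler_pM ?mulr_ge0// ler_wpM2l.
have -> : n%:R * 2 * ((1 + n%:R * h1 * h) * (d * a)) = d * C * a.
  by rewrite /C; ring.
rewrite ler_wpM2r// (le_trans _ de)// ler_wpM2l ?lerDl//.
exact: le_trans ad'.
Qed.

Lemma closed_group_pow (G : set 'M[R]_n) g m :
  closed_linear_group G -> G g -> G (g ^+ m).
Proof.
move=> GG Gg; elim: m => [|m IH]; first exact: clg_one GG.
by rewrite exprS; apply: (clg_mul GG).
Qed.

(** Mutual inverseness passes to the limit. This shows that [expmx (t *: H)] is invertible without
    the addition formula for exponentials. *)
Lemma mulmx_eq1_approx A B :
  (forall e : R, 0 < e -> exists x y : 'M[R]_n,
     x *m y = 1%:M /\ (`|x - A| <= e /\ `|y - B| <= e)) -> A *m B = 1%:M.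
Proof.
move=> approx.
apply/eqP; rewrite -subr_eq0 -normr_le0; apply/ler_addgt0Pr => e e0; rewrite add0r.
pose C := n%:R * (`|B| + `|A| + 1) + 1.
have C0 : 0 < C by rewrite ltr_wpDl// mulr_ge0// !addr_ge0.
have d0 : 0 < Num.min 1 (e / C) by rewrite lt_min ltr01 divr_gt0.
have [x [y [xy []]]] := approx _ d0; rewrite !le_min => /andP[x1 xe] /andP[_ ye].
have -> : A *m B - 1%:M = x *m (B - y) - (x - A) *m B.
  by rewrite -xy mulmxBr mulmxBl opprB [RHS]addrC addrA subrK.
have xle : `|x| <= `|A| + 1.
  by rewrite -(subrK A x) addrC (le_trans (ler_normD _ _))// lerD2l.
rewrite (le_trans (ler_normB _ _))//.
rewrite (@le_trans _ _ (n%:R * (`|A| + 1) * (e / C) + n%:R * (e / C) * `|B|))//.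
  rewrite lerD// (le_trans (mx_normM _ _))//.
    by rewrite ler_pM ?mulr_ge0// ?ler_wpM2l// distrC.
  by rewrite ler_wpM2r// ler_wpM2l.
have -> : n%:R * (`|A| + 1) * (e / C) + n%:R * (e / C) * `|B| = (C - 1) * (e / C).
  by rewrite /C; ring.
by rewrite mulrA ler_pdivrMr// mulrC ler_wpM2l ?(ltW e0)// gerBl.
Qed.

(** Powers of [g] and of [invmx g] approximate the exponentials at [t] and [- t]. These are thus
    mutually inverse, hence in [GL], and the closedness of [G] relative to [GL] applies. *)
Lemma tangent_lie_algebra (G : set 'M[R]_n) H :
  closed_linear_group G -> tangent G H -> lie_algebra G H.
Proof.
move=> GG tH.
have approx t e : 0 <= t -> 0 < e -> exists x y,
    [/\ G x, G y, x *m y = 1%:M & `|x - expmx (t *: H)| <= e /\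
       `|y - expmx ((- t) *: H)| <= e].
  move=> t0 e0; have [d d0 Hd] := pow_near_expmx H t0 e0.
  have [d' d'0 Hd'] := pow_near_expmx (- H) t0 e0.
  have [d'' d''0 Hd''] := invmx_near H d'0.
  have m0 : 0 < Num.min d (Num.min d' d'') by rewrite !lt_min d0 d'0.
  have [a [g []]] := tH _ m0; rewrite !lt_min => /andP[a0 /and3P[ad ad' ad'']].
  move=> Gg gle; have gu := clg_unit GG Gg.
  have le c : Num.min d (Num.min d' d'') <= c -> `|g - 1%:M - a *: H| <= c * a.
    by move=> mc; apply: le_trans gle _; rewrite ler_wpM2r// ltW.
  exists (g ^+ Num.truncn (t / a)), (invmx g ^+ Num.truncn (t / a)); split.
  - exact: closed_group_pow.
  - by apply: closed_group_pow => //; exact: clg_inv.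
  - have cg : GRing.comm g (invmx g) by rewrite /GRing.comm -!mulmxE mulmxV// mulVmx.
    by rewrite mulmxE -exprMn_comm// -mulmxE mulmxV// expr1n.
  split; first by apply: Hd; rewrite ?a0// le// ge_min lexx.
  rewrite scaleNr -scalerN; apply: Hd'; first by rewrite a0.
  by apply: Hd''; rewrite ?a0// le// !ge_min lexx !orbT.
have expV t : 0 <= t -> expmx (t *: H) *m expmx ((- t) *: H) = 1%:M.
  move=> t0; apply: mulmx_eq1_approx => e e0.
  by have [x [y [_ _ xy xyE]]] := approx t e t0 e0; exists x, y.
have cl A : (forall e, 0 < e -> exists2 x, G x & `|x - A| <= e) -> closure G A.
  move=> GA U /(@nbhs_ballP _ 'M[R]_n)[e /= e0 eU].
  have [x Gx xA] := GA (e / 2) (divr_gt0 e0 (ltr0n _ 2)).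
  exists x; split=> //; apply: eU; rewrite -ball_normE /= distrC.
  by apply: le_lt_trans xA _; rewrite ltr_pdivrMr// ltr_pMr// ltr1n.
suff both t : 0 <= t -> G (expmx (t *: H)) /\ G (expmx ((- t) *: H)).
  move=> t; have [/both[]//|t0] := leP 0 t.
  by rewrite -[t]opprK; have [] := both (- t); rewrite ?oppr_ge0 ?ltW.
move=> t0; have [Eu Fu] := mulmx1_unit (expV t t0).
split; apply: (clg_closed GG) => //; apply: cl => e e0.
  by have [x [y [Gx _ _ [xE _]]]] := approx t e t0 e0; exists x.
by have [x [y [_ Gy _ [_ yF]]]] := approx t e t0 e0; exists y.
Qed.

(** Here, unlike in [tangent], every small [a] works, so elements for two directions can be taken at
    the same [a]. *)
Lemma lie_algebra_tangent (G : set 'M[R]_n) H (e : R) :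
  lie_algebra G H -> 0 < e -> exists2 d, 0 < d & forall a, 0 < a < d ->
  exists2 g, G g & `|g - 1%:M - a *: H| <= e * a.
Proof.
move=> GH e0; have [c c0 Hc] := expmx_taylor1 R n.
have h0 : 0 < `|H| + 1 by rewrite ltr_wpDl.
have d0 : 0 < c * (`|H| + 1) ^+ 2 by rewrite mulr_gt0// exprn_gt0.
exists (Num.min (`|H| + 1)^-1 (e / (c * (`|H| + 1) ^+ 2))) => [|a].
  by rewrite lt_min invr_gt0 h0 divr_gt0.
rewrite lt_min => /and3P[a0 a1 ae]; exists (expmx (a *: H)); first exact: GH.
have aH : `|a *: H| <= a * (`|H| + 1) by rewrite normrZ gtr0_norm// ler_pM2l// lerDl.
have aH1 : `|a *: H| <= 1.
  by rewrite (le_trans aH)// -ler_pdivlMr// div1r ltW.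
rewrite (le_trans (Hc _ aH1))//.
rewrite (@le_trans _ _ (c * (a * (`|H| + 1)) ^+ 2))//.
  by rewrite ler_pM2l// lerXn2r// nnegrE// mulr_ge0// ltW.
have -> : c * (a * (`|H| + 1)) ^+ 2 = a * (c * (`|H| + 1) ^+ 2) * a by ring.
by rewrite ler_pM2r// -ler_pdivlMr// ltW.
Qed.

Lemma lie_algebraZ (G : set 'M[R]_n) H (c : R) :
  lie_algebra G H -> lie_algebra G (c *: H).
Proof. by move=> GH t; rewrite scalerA; exact: GH. Qed.

(** The product of group elements near [1 + a H] and [1 + a K] is [1 + a (H + K)] up to small
    multiples of [a] and a product of two terms of order [a]. *)
Lemma lie_algebraD (G : set 'M[R]_n) H K : closed_linear_group G ->
  lie_algebra G H -> lie_algebra G K -> lie_algebra G (H + K).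
Proof.
move=> GG GH GK; apply: tangent_lie_algebra => // e e0.
pose h := `|H| + 1; pose k := `|K| + 1.
have h0 : 0 < h by rewrite ltr_wpDl.
have k0 : 0 < k by rewrite ltr_wpDl.
have n0 : 0 <= n%:R :> R by [].
pose C := 2 + n%:R * h * k.
have C0 : 0 < C by rewrite ltr_pwDl// !mulr_ge0// ltW.
have [e' [e'0 e'1 e'e]] : exists e' : R, [/\ 0 < e', e' <= 1 & e' * C <= e].
  exists (Num.min 1 (e / C)).
  by rewrite -ler_pdivlMr// lt_min ltr01 divr_gt0// !ge_min !lexx orbT.
have [d d0 Hd] := lie_algebra_tangent GH e'0.
have [d' d'0 Hd'] := lie_algebra_tangent GK e'0.
pose a := Num.min (Num.min e e') (Num.min d d') / 2.
have a0 : 0 < a by rewrite divr_gt0// !lt_min e0 e'0 d0.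
have : a < Num.min (Num.min e e') (Num.min d d').
  by rewrite ltr_pdivrMr// ltr_pMr ?ltr1n// !lt_min e0 e'0 d0.
rewrite !lt_min => /andP[/andP[ae ae'] /andP[ad ad']].
have [|x Gx xle] := Hd a; first by rewrite a0.
have [|y Gy yle] := Hd' a; first by rewrite a0.
exists a, (x *m y); split; [by rewrite a0|exact: (clg_mul GG)|].
have small (z L : 'M[R]_n) : `|z - 1%:M - a *: L| <= e' * a -> `|z - 1%:M| <= a * (`|L| + 1).
  move=> zle; rewrite -(subrK (a *: L) (z - 1%:M)) (le_trans (ler_normD _ _))//.
  by rewrite normrZ gtr0_norm// mulrDr mulr1 addrC lerD2l (le_trans zle)// ler_piMl// ltW.
have -> : x *m y - 1%:M - a *: (H + K) =
    (x - 1%:M - a *: H) + (y - 1%:M - a *: K) + (x - 1%:M) *m (y - 1%:M).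
  rewrite mulmxBr mulmx1 mulmxBl mul1mx scalerDr.
  move: (x *m y) (a *: H) (a *: K) 1%:M => xy aH aK I.
  apply/matrixP => i j; rewrite !mxE; ring.
have xy : `|(x - 1%:M) *m (y - 1%:M)| <= n%:R * h * k * (e' * a).
  rewrite (le_trans (mx_normM _ _))//.
  rewrite (@le_trans _ _ (n%:R * (a * h) * (a * k)))//.
    by rewrite ler_pM ?mulr_ge0// ?ler_wpM2l ?small.
  have -> : n%:R * (a * h) * (a * k) = n%:R * h * k * (a * a) by ring.
  rewrite ler_wpM2l ?mulr_ge0 ?(ltW h0) ?(ltW k0)// ler_wpM2r ?(ltW a0)//.
  exact: ltW.
rewrite (le_trans (ler_normD _ _))// (le_trans (lerD (ler_normD _ _) xy))//.
rewrite (le_trans (lerD (lerD xle yle) (lexx _)))//.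
have -> : e' * a + e' * a + n%:R * h * k * (e' * a) = e' * C * a by rewrite /C; ring.
by rewrite ler_wpM2r// ltW.
Qed.

(** The adjoint is linear, bounded and fixes [1], so it maps tangent directions to tangent
    directions. *)
Lemma lie_algebra_adjoint (G : set 'M[R]_n) Q H : closed_linear_group G ->
  posdef Q -> (forall g, G g -> G (adjoint Q g)) ->
  lie_algebra G H -> lie_algebra G (adjoint Q H).
Proof.
move=> GG Qpd GQ GH; apply: tangent_lie_algebra => // e e0.
have Qu := posdef_unitmx Qpd.
pose C := n%:R * (n%:R * `|invmx Q|) * `|Q| + 1.
have C0 : 0 < C by rewrite ltr_wpDl// !mulr_ge0.
have [d d0 Hd] := lie_algebra_tangent GH (divr_gt0 e0 C0).
pose a := Num.min e d / 2.
have a0 : 0 < a by rewrite divr_gt0// !lt_min e0 d0.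
have : a < Num.min e d by rewrite ltr_pdivrMr// ltr_pMr ?ltr1n// !lt_min e0 d0.
rewrite lt_min => /andP[ae ad].
have [|g Gg gle] := Hd a; first by rewrite a0.
exists a, (adjoint Q g); split; [by rewrite a0|exact: GQ|].
have -> : adjoint Q g - 1%:M - a *: adjoint Q H = invmx Q *m (g - 1%:M - a *: H)^T *m Q.
  have trE : (g - 1%:M - a *: H)^T = g^T - 1%:M - a *: H^T.
    by apply/matrixP => i j; rewrite !mxE eq_sym.
  rewrite !adjointE// trE !mulmxBr !mulmxBl mulmx1 mulVmx//.
  by rewrite -scalemxAr -scalemxAl.
rewrite (le_trans (mx_normM _ _))//.
rewrite (@le_trans _ _ ((C - 1) * `|g - 1%:M - a *: H|))//.
  have -> : (C - 1) * `|g - 1%:M - a *: H| =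
    n%:R * (n%:R * `|invmx Q| * `|g - 1%:M - a *: H|) * `|Q| by rewrite /C; ring.
  by rewrite ler_wpM2r// ler_wpM2l// (le_trans (mx_normM _ _))// mx_norm_tr.
apply: le_trans (ler_wpM2l _ gle) _; first by rewrite addrK !mulr_ge0.
by rewrite mulrA ler_wpM2r ?(ltW a0)// mulrCA ler_piMr ?(ltW e0)// ler_pdivrMr// mul1r gerBl.
Qed.


End LieAlgebraTheory.

(** * Compactness in matrix spaces *)

Section Compactness.
Variable R : realType.

Lemma cvg_mulmx (T : Type) (F : set_system T) {FF : Filter F} (m n p : nat)
    (u : T -> 'M[R]_(m, n)) (v : T -> 'M[R]_(n, p)) (a : 'M[R]_(m, n)) (b : 'M[R]_(n, p)) :
  u @ F --> a -> v @ F --> b -> (fun x => u x *m v x) @ F --> a *m b.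
Proof.
move=> ua vb.
rewrite (_ : (fun x => u x *m v x) = fun x => u x *m b + u x *m (v x - b)); last first.
  by apply/funext => x; rewrite mulmxBr addrC subrK.
rewrite -[a *m b]addr0; apply: cvgD; first exact: cvg_mulmxr.
apply/cvgr0Pnorm_le => e e0.
have c0 : 0 < n%:R * (`|a| + 1) + 1 by rewrite ltr_wpDl// mulr_ge0// addr_ge0.
near=> x.
have ux : `|u x| <= `|a| + 1.
  rewrite -(subrK a (u x)) addrC (le_trans (ler_normD _ _))// lerD2l distrC.
  by near: x; apply: cvgr_dist_le.
rewrite (le_trans (mx_normM _ _))//.
rewrite (@le_trans _ _ ((n%:R * (`|a| + 1) + 1) * `|v x - b|))//.
  by rewrite ler_wpM2r// (le_trans (ler_wpM2l _ ux))// lerDl.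
rewrite mulrC -ler_pdivlMr// distrC; near: x.
by apply: cvgr_dist_le => //; rewrite divr_gt0.
Unshelve. all: by end_near. Qed.

Lemma vec_mx_continuous (m n : nat) : continuous (vec_mx : 'rV[R]_(m * n) -> 'M[R]_(m, n)).
Proof.
move=> v; apply/(@cvgrPdist_le _ _ _ (nbhs v)) => e e0; near=> w.
rewrite -linearB /=; apply: (@le_trans _ _ `|v - w|).
  by apply/mx_norm_leP => // i j; rewrite mxE le_coord_mx_norm.
by near: w; apply: cvgr_dist_le => //; exact: cvg_id.
Unshelve. all: by end_near. Qed.

(** Heine-Borel is transported from row vectors through the continuous surjection [vec_mx]. *)
Lemma mx_bounded_closed_compact (m n : nat) (A : set 'M[R]_(m, n)) (c : R) :
  (forall M, A M -> `|M| <= c) -> closed A -> compact A.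
Proof.
move=> Ac Acl.
have -> : A = vec_mx @` (vec_mx @^-1` A).
  apply/seteqP; split=> [M AM|_ [v Av <-]//].
  by exists (mxvec M); rewrite /= mxvecK.
apply: continuous_compact.
  by apply: continuous_subspaceT; exact: vec_mx_continuous.
apply: bounded_closed_compact; last first.
  by apply: closed_comp => // v _; exact: vec_mx_continuous.
exists c; split; first exact: num_real.
move=> c' cc' v /= /Ac vc; apply: (@le_trans _ _ c); last exact: ltW.
have c0 : 0 <= c := le_trans (normr_ge0 _) vc.
apply/mx_norm_leP => // i j; rewrite ord1 -[v]vec_mxK; case/mxvec_indexP: j => k l.
by rewrite mxvecE (le_trans _ vc)// le_coord_mx_norm.
Qed.

Lemma mx_sphere_compact (m n : nat) : compact [set M : 'M[R]_(m, n) | `|M| = 1].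
Proof.
apply: (@mx_bounded_closed_compact _ _ _ 1) => [M ->//|].
apply: (@closed_comp _ _ (fun M : 'M[R]_(m, n) => `|M|) [set 1]).
  by move=> M _; exact: norm_continuous.
exact: closed_eq.
Qed.

End Compactness.

(** * Minima on finite sets and minimal subsets *)

Section FiniteSets.

Lemma finite_set_min (T : eqType) (R : realType) (A : set T) (f : T -> R) :
  finite_set A -> A !=set0 -> exists2 x, A x & forall y, A y -> f x <= f y.
Proof.
case/finite_seqP => s ->; elim: s => [[x]//|a s IH _].
case: s IH => [_|b s IH].
  by exists a => [|y /=]; rewrite /= inE// => /eqP->.
have [|x xs xmin] := IH; first by exists b; rewrite /= inE eqxx.
have [fax|fxa] := leP (f a) (f x).
  exists a => [|y]; first by rewrite /= inE eqxx.
  by rewrite /= inE => /predU1P[->//|ys]; apply: le_trans (xmin y ys).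
exists x => [|y]; first by rewrite /= inE; apply/orP; right.
by rewrite /= inE => /predU1P[->|ys]; [exact: ltW|exact: xmin].
Qed.

Lemma finite_set_minimal (T : choiceType) (A : set T) (P : set T -> Prop) :
  finite_set A -> P A ->
  exists B, [/\ B `<=` A, P B & forall C, C `<=` B -> P C -> C = B].
Proof.
case/finite_seqP => s sA; have : A `<=` [set` s] by rewrite sA.
move: {2}(size s) (leqnn (size s)) => m.
elim: m => [|m IH] in s A {sA} *.
  rewrite leqn0 size_eq0 => /eqP -> A0 PA; exists A; split => // C CA _.
  by apply/seteqP; split=> // x /A0.
move=> sm As PA.
have [Amin|] := pselect (forall C, C `<=` A -> P C -> C = A).
  by exists A; split.
move=> /existsNP[C /not_implyP[CA /not_implyP[PC CneA]]].
have [a Aa Ca] : exists2 a, A a & ~ C a.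
  apply: contrapT => noa; apply: CneA; apply/seteqP; split=> // x Ax.
  by apply: contrapT => Cx; apply: noa; exists x.
have [|x Cx|//|B [BC PB Bmin]] := IH [seq x <- s | x != a] C.
- rewrite -ltnS (leq_trans _ sm)// size_filter ltn_neqAle count_size andbT.
  by rewrite -all_count; apply/negP => /allP/(_ _ (As a Aa)); rewrite /= eqxx.
- rewrite /= mem_filter /=; apply/andP; split; last exact/As/CA.
  by apply/eqP => xa; rewrite xa in Cx.
by exists B; split=> //; apply: subset_trans CA.
Qed.

End FiniteSets.

(** * Limits of directions in a closed linear group *)

Section GroupDirection.
Variables (R : realType) (n : nat).

(** [D] is a cluster point of the normalised [q k - 1] on the compact unit sphere. The elements of
    [C] that realise [D] are returned as well, so that further properties of [C] can be passed to
    the limit. *)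
Lemma limit_direction (G C : set 'M[R]_n) : closed_linear_group G -> C `<=` G ->
  (forall e : R, 0 < e -> exists2 q, C q & 0 < `|q - 1%:M| < e) ->
  exists D, [/\ lie_algebra G D, `|D| = 1 & forall e : R, 0 < e -> exists q,
    [/\ C q, 0 < `|q - 1%:M| < e & `|q - 1%:M - `|q - 1%:M| *: D| <= e * `|q - 1%:M|]].
Proof.
move=> GG CG acc.
have /choice[q qP] : forall k : nat, exists q, C q /\ 0 < `|q - 1%:M| < k.+1%:R^-1.
  by move=> k; have [|q Cq q1] := acc k.+1%:R^-1; [rewrite invr_gt0|exists q].
pose a k := `|q k - 1%:M|; pose d k := (a k)^-1 *: (q k - 1%:M).
have a0 k : 0 < a k by case: (qP k) => _ /andP[].
have d1 k : `|d k| = 1 by rewrite normrZ normfV normr_id mulVf// gt_eqF// a0.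
have [|D [/= D1 clD]] := @mx_sphere_compact R n n (d @ \oo) _.
  by exists 0%N => // k _ /=; exact: d1.
have near_D e : 0 < e -> exists q, [/\ C q, 0 < `|q - 1%:M| < e &
    `|q - 1%:M - `|q - 1%:M| *: D| <= e * `|q - 1%:M|].
  move=> e0; have [N _ Ne] := near_infty_natSinv_lt (PosNum e0).
  have tail : (d @ \oo) (d @` [set k | (N <= k)%N]).
    by exists N => // k /= Nk; exists k.
  have [_ [[k /= Nk <-]]] := clD _ _ tail (nbhsx_ballx D e e0).
  rewrite -ball_normE /= => Ddk; exists (q k); have [Cq /andP[q0 qk]] := qP k.
  split=> //; first by rewrite q0 (lt_trans qk (Ne k Nk)).
  have -> : q k - 1%:M - `|q k - 1%:M| *: D = - (a k *: (D - d k)).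
    by rewrite scalerBr opprB scalerA divff ?gt_eqF ?a0// scale1r.
  by rewrite normrN normrZ normr_id mulrC ler_wpM2r// ltW.
exists D; split=> //; apply: tangent_lie_algebra => // e e0.
have [p [Cp pe ple]] := near_D e e0.
by exists `|p - 1%:M|, p; split=> //; exact: CG.
Qed.

End GroupDirection.

(** * Positive definite forms and the Hermite function *)

Section QuadraticFormTheory.
Variables (R : realType) (n : nat).
Implicit Types (A Q P g H K D : 'M[R]_n) (x y z : 'cV[R]_n) (Z : set 'cV[R]_n).

Lemma bformDr Q x y z : bform Q x (y + z) = bform Q x y + bform Q x z.
Proof. by rewrite /bform mulmxDr mxE. Qed.

Lemma bformDl Q x y z : bform Q (x + y) z = bform Q x z + bform Q y z.
Proof. by rewrite /bform linearD /= !mulmxDl mxE. Qed.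

Lemma bformBr Q x y z : bform Q x (y - z) = bform Q x y - bform Q x z.
Proof. by rewrite /bform mulmxBr !mxE. Qed.

Lemma bformZr Q x (c : R) y : bform Q x (c *: y) = c * bform Q x y.
Proof. by rewrite /bform -scalemxAr mxE. Qed.

Lemma bformZl Q x (c : R) y : bform Q (c *: x) y = c * bform Q x y.
Proof. by rewrite /bform linearZ /= -!scalemxAl mxE. Qed.

Lemma bform0r Q x : bform Q x 0 = 0.
Proof. by rewrite /bform mulmx0 mxE. Qed.

Lemma bformC Q x y : Q^T = Q -> bform Q x y = bform Q y x.
Proof.
move=> Qsym; rewrite /bform; have -> : y^T *m Q *m x = (x^T *m Q *m y)^T.
  by rewrite !trmx_mul trmxK Qsym mulmxA.
by rewrite [RHS]mxE.
Qed.

Lemma bform_bound Q x y : `|bform Q x y| <= n%:R ^+ 2 * `|Q| * `|x| * `|y|.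
Proof.
rewrite /bform (le_trans (le_coord_mx_norm _ _ _))// (le_trans (mx_normM _ _))//.
rewrite ler_wpM2r// (@le_trans _ _ (n%:R * (n%:R * `|x^T| * `|Q|)))//.
  by rewrite ler_wpM2l// mx_normM.
by rewrite mx_norm_tr le_eqVlt; apply/orP; left; apply/eqP; ring.
Qed.

Lemma posdef_qform_ge0 Q x : posdef Q -> 0 <= qform Q x.
Proof.
move=> [_ Qpos]; have [->|x0] := eqVneq x 0; first by rewrite /qform bform0r.
by rewrite ltW// Qpos.
Qed.

Lemma qform_continuous Q : continuous (@qform R n Q).
Proof.
move=> x.
have c : (fun y : 'cV[R]_n => y^T *m Q *m y) @ nbhs x --> x^T *m Q *m x.
  apply: cvg_mulmx; last exact: cvg_id.
  apply: (@cvg_mulmxr _ _ (nbhs x)).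
  by apply: (@cvg_trmx _ _ (nbhs x)); exact: cvg_id.
apply: (@continuous_cvg _ _ _ (nbhs x) _ _ (fun M : 'M[R]_1 => M 0 0)) => //.
exact: coord_continuous.
Qed.

Lemma posdef_coercive Q : posdef Q ->
  exists2 c : R, 0 < c & forall x, c * `|x| ^+ 2 <= qform Q x.
Proof.
move=> Qpd; have [_ Qpos] := Qpd.
have [S0|S0] := pselect ([set x : 'cV[R]_n | `|x| = 1] !=set0); last first.
  (* An empty sphere means that [0] is the only vector, and any positive constant works. *)
  exists 1 => // x; have [->|x0] := eqVneq x 0.
    by rewrite normr0 expr0n mulr0 posdef_qform_ge0.
  exfalso; apply: S0; exists (`|x|^-1 *: x).
  by rewrite /= normrZ normfV normr_id mulVf// normr_eq0.
have [|c] := compact_EVT_min S0 (@mx_sphere_compact R n 1) (f := qform Q).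
  by apply: continuous_subspaceT; exact: qform_continuous.
rewrite inE /= => c1 cmin.
have c0 : c != 0 by rewrite -normr_eq0 c1 oner_eq0.
exists (qform Q c); first exact: Qpos.
move=> x; have [->|x0] := eqVneq x 0.
  by rewrite normr0 expr0n mulr0 posdef_qform_ge0.
have nx0 : 0 < `|x| by rewrite normr_gt0.
have := cmin (`|x|^-1 *: x); rewrite inE /= normrZ normfV normr_id mulVf ?gt_eqF//.
move=> /(_ erefl); rewrite [X in _ <= X]/qform bformZl bformZr mulrA -invfM.
by rewrite mulrC ler_pdivlMr ?mulr_gt0// -expr2.
Qed.

(** Such a set is compact, and it is covered by open sets each containing a single point of [Z]. *)
Lemma sublevel_finite Z P (r : R) : closed Z -> Z `<=` isolated Z -> posdef P ->
  finite_set [set x | Z x /\ qform P x <= r].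
Proof.
move=> Zcl Zdisc Ppd; have [c c0 Pc] := posdef_coercive Ppd.
set K := [set x | _].
have : compact K.
  apply: (@mx_bounded_closed_compact _ _ _ _ (`|r| / c + 1)) => [x [_ xr]|].
    have xc : `|x| ^+ 2 <= `|r| / c.
      by rewrite ler_pdivlMr// mulrC (le_trans (Pc x))// (le_trans xr)// ler_norm.
    have : 0 <= `|x| by []. have : 0 <= `|r| / c by rewrite divr_ge0// ltW.
    nra.
  apply: closedI => //.
  apply: (@closed_comp _ _ (@qform R n P) [set t | t <= r]); last exact: closed_le.
  by move=> x _; exact: qform_continuous.
rewrite compact_cover => Kcov.
have /choice[V VP] : forall x, exists V : set 'cV[R]_n,
    open V /\ (Z x -> V x /\ V `&` Z `<=` [set x]).
  move=> x; have [Zx|nZx] := pselect (Z x); last by exists setT; split; first exact: openT.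
  have [_ [V xV VZ]] := Zdisc x Zx; exists V°; split; first exact: open_interior.
  split=> //; rewrite -VZ; apply: setSI; exact: interior_subset.
have [||s sK Ks] := Kcov _ K V.
- by move=> x _; case: (VP x).
- by move=> x [Zx xr]; exists x => //; case: (VP x) => _ /(_ Zx)[].
apply: sub_finite_set (finite_fset s).
move=> x Kx; have [y ys Vyx] := Ks x Kx.
have [Zy _] : K y by have := sK y ys; rewrite inE.
have [_ /(_ Zy)[_ Vy]] := VP y; have [Zx _] := Kx.
by have -> : x = y by apply: Vy.
Qed.

Section Hermite.
Variable Z : set 'cV[R]_n.
Hypotheses (Zcl : closed Z) (Zdisc : Z `<=` isolated Z) (Z0 : ~ Z 0).
Hypothesis Zne : Z !=set0.

Lemma hermite_attained P : posdef P -> exists2 x, Z x &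
  qform P x = hermite Z P /\ forall y, Z y -> hermite Z P <= qform P y.
Proof.
move=> Ppd; have [z Zz] := Zne.
have [|x [Zx xz] xmin] :=
  @finite_set_min _ R _ (qform P) (sublevel_finite (qform P z) Zcl Zdisc Ppd).
  by exists z; split.
have xminZ y : Z y -> qform P x <= qform P y.
  move=> Zy; have [yz|zy] := leP (qform P y) (qform P z); first by apply: xmin.
  by apply: le_trans xz (ltW zy).
(* A minimum exists, so [hermite] is not the default value of [xget]. *)
have : [set m | (qform P @` Z) m /\ lbound (qform P @` Z) m] (hermite Z P).
  rewrite /hermite; case: xgetP => [m _ //|/(_ (qform P x))[]].
  by split; [exists x|move=> _ [y Zy <-]; exact: xminZ].
move=> [[y Zy <-] lb]; exists y => //; split=> // w Zw.
by apply: lb; exists w.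
Qed.

Lemma hermite_le P y : posdef P -> Z y -> hermite Z P <= qform P y.
Proof. by move=> /hermite_attained[x _ [_ +]]; apply. Qed.

Lemma Qmin_neq0 P : posdef P -> Qmin Z P !=set0.
Proof. by move=> /hermite_attained[x Zx [xh _]]; exists x. Qed.

Lemma Qmin_finite P : posdef P -> finite_set (Qmin Z P).
Proof.
move=> Ppd; apply: sub_finite_set (sublevel_finite (hermite Z P) Zcl Zdisc Ppd).
by move=> x [Zx xh]; split; rewrite /= ?xh.
Qed.

Lemma hermite_gt0 P : posdef P -> 0 < hermite Z P.
Proof.
move=> Ppd; have [x Zx [<- _]] := hermite_attained Ppd; apply: Ppd.2.
by apply/eqP => x0; rewrite x0 in Zx.
Qed.

(** Only finitely many vectors of [Z] have value at most [h + 1], so the values above the minimum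
    stay away from it. *)
Lemma hermite_gap P : posdef P -> exists2 c : R, hermite Z P < c &
  forall x, Z x -> ~ Qmin Z P x -> c <= qform P x.
Proof.
move=> Ppd; pose h := hermite Z P.
have hlt x : Z x -> ~ Qmin Z P x -> h < qform P x.
  move=> Zx nx; rewrite lt_neqAle hermite_le// andbT; apply/eqP => xh.
  by apply: nx; split.
pose A := [set x | [/\ Z x, qform P x <= h + 1 & ~ Qmin Z P x]].
have Afin : finite_set A.
  apply: sub_finite_set (sublevel_finite (h + 1) Zcl Zdisc Ppd).
  by move=> x [Zx xh _]; split.
have [A0|A0] := pselect (A !=set0).
  have [x [Zx xh nx] xmin] := @finite_set_min _ R _ (qform P) Afin A0.
  exists (qform P x); first exact: hlt.
  move=> y Zy ny; have [yh|hy] := leP (qform P y) (h + 1); first by apply: xmin.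
  exact: le_trans xh (ltW hy).
exists (h + 1) => [|x Zx nx]; first by rewrite ltrDl.
by rewrite leNgt; apply/negP => xh; apply: A0; exists x; split=> //; exact: ltW.
Qed.

(** A nearby form changes every value by a relative error at most [e]; for [e] small against the
    gap, the other vectors of [Z] stay above the minimal ones of [P]. Locally, [hermite] is thus
    decided on the finite set [Qmin Z P]. *)
Lemma hermite_near P : posdef P -> \forall P' \near P, posdef P' ->
  exists2 x, Qmin Z P x & qform P' x = hermite Z P'.
Proof.
move=> Ppd; have [c c0 Pc] := posdef_coercive Ppd.
have [g hg gap] := hermite_gap Ppd; pose h := hermite Z P.
have h0 : 0 < h := hermite_gt0 Ppd.
have n0 : 0 < n%:R ^+ 2 + 1 :> R by rewrite ltr_wpDl// exprn_ge0.
have [e e0 [e1 ehg]] : exists2 e : R, 0 < e & e < 1 /\ (1 + e) * h < (1 - e) * g.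
  have gh0 : 0 < g + h by rewrite addr_gt0// (lt_trans h0).
  (* Half of the [t] that solves [(1 + t) h = (1 - t) g]. *)
  exists ((g - h) / (g + h) / 2); first by rewrite !divr_gt0// subr_gt0.
  set t := _ / (g + h); have tE : t * (g + h) = g - h by rewrite divfK ?gt_eqF.
  have t0 : 0 < t by rewrite divr_gt0// subr_gt0.
  split; first by rewrite ltr_pdivrMr// mul1r; nra.
  nra.
near=> P'.
have PP' : `|P - P'| <= e * c / (n%:R ^+ 2 + 1).
  near: P'; apply: (@cvgr_dist_le _ _ _ (nbhs P)); first exact: cvg_id.
  by rewrite divr_gt0// mulr_gt0.
have close x : `|qform P' x - qform P x| <= e * qform P x.
  have -> : qform P' x - qform P x = - bform (P - P') x x.
    by rewrite /qform /bform mulmxBr mulmxBl !mxE opprB.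
  rewrite normrN (le_trans (bform_bound _ _ _))//.
  rewrite (@le_trans _ _ (e * c * `|x| ^+ 2))//; last first.
    by rewrite -mulrA ler_wpM2l// ltW.
  rewrite -mulrA -expr2 ler_wpM2r ?exprn_ge0//.
  move: PP'; rewrite ler_pdivlMr//; apply: le_trans.
  by rewrite mulrC ler_wpM2l// lerDl.
move=> P'pd; have [x Zx [xh xmin]] := hermite_attained P'pd.
exists x => //; apply: contrapT => nx.
have [z [Zz zh]] := Qmin_neq0 Ppd.
have gx := gap x Zx nx.
have := close x; have := close z; rewrite zh !ler_norml -/h => /andP[_ zle] /andP[xle _].
have := xmin z Zz; rewrite -xh.
have : (1 - e) * g <= (1 - e) * qform P x by rewrite ler_wpM2l// subr_ge0 ltW.
lra.
Unshelve. all: by end_near. Qed.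

End Hermite.
End QuadraticFormTheory.

(** * Adjoints and self-adjoint elements with respect to [Q] *)

Section SelfAdjoint.
Variables (R : realType) (n : nat) (Q : 'M[R]_n).
Hypothesis Qpd : posdef Q.
Implicit Types (A B g H K D : 'M[R]_n) (x y : 'cV[R]_n).
Local Notation adj := (adjoint Q).

Lemma adjointD A B : adj (A + B) = adj A + adj B.
Proof. by rewrite !adjointE// linearD /= mulmxDr mulmxDl. Qed.

Lemma adjointZ (c : R) A : adj (c *: A) = c *: adj A.
Proof. by rewrite !adjointE// linearZ /= -scalemxAr -scalemxAl. Qed.

Lemma adjointN A : adj (- A) = - adj A.
Proof. by rewrite -[- A]scaleN1r adjointZ scaleN1r. Qed.

Lemma adjoint1 : adj 1%:M = 1%:M.
Proof. by rewrite adjointE// trmx1 mulmx1 mulVmx// posdef_unitmx. Qed.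

Lemma adjointM A B : adj (A *m B) = adj B *m adj A.
Proof.
rewrite !adjointE// trmx_mul !mulmxA -[_ *m Q *m invmx Q]mulmxA.
by rewrite mulmxV ?posdef_unitmx// mulmx1.
Qed.

Lemma bform_adjoint g x y : bform Q x (g *m y) = bform Q (adj g *m x) y.
Proof. by move: x y; apply/is_adjointE => //; rewrite adjointE. Qed.

Lemma adjointK : involutive adj.
Proof.
move=> A; rewrite [LHS]adjointE// (adjointE A Qpd) !trmx_mul trmxK trmx_inv Qpd.1.
by rewrite !mulmxA mulVmx ?posdef_unitmx// mul1mx -mulmxA mulVmx ?posdef_unitmx// mulmx1.
Qed.

Lemma adjoint_bound : exists2 c : R, 1 <= c & forall A, `|adj A| <= c * `|A|.
Proof.
exists (n%:R * (n%:R * `|invmx Q|) * `|Q| + 1) => [|A].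
  by rewrite lerDr !mulr_ge0.
rewrite adjointE// (le_trans (mx_normM _ _))//.
rewrite (@le_trans _ _ (n%:R * (n%:R * `|invmx Q|) * `|Q| * `|A|))//.
  have -> : n%:R * (n%:R * `|invmx Q|) * `|Q| * `|A| =
    n%:R * (n%:R * `|invmx Q| * `|A|) * `|Q| by ring.
  by rewrite ler_wpM2r// ler_wpM2l// (le_trans (mx_normM _ _))// mx_norm_tr.
by rewrite ler_wpM2r// lerDl.
Qed.

(** The self-adjoint part: it has the same values [Q(x, H x)] as [H] and stays in the Lie algebra,
    which is stable under the adjoint. *)
Definition sympart H : 'M[R]_n := 2^-1 *: (H + adj H).

Lemma adjoint_sympart H : adj (sympart H) = sympart H.
Proof. by rewrite adjointZ adjointD adjointK addrC. Qed.

Lemma bform_sympart H x : bform Q x (sympart H *m x) = bform Q x (H *m x).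
Proof.
rewrite -scalemxAl bformZr mulmxDl bformDr (bform_adjoint (adj H)) adjointK.
by rewrite [bform Q (_ *m x) x]bformC ?Qpd.1//; field.
Qed.

Lemma lie_algebra_sympart (G : set 'M[R]_n) H : closed_linear_group G ->
  (forall g, G g -> G (adj g)) -> lie_algebra G H -> lie_algebra G (sympart H).
Proof.
move=> GG GQ GH; apply: lie_algebraZ; apply: lie_algebraD => //.
exact: lie_algebra_adjoint.
Qed.

Lemma bform_mul_bound x : exists2 c : R, 0 < c &
  forall A, `|bform Q x (A *m x)| <= c * `|A|.
Proof.
exists (n%:R ^+ 2 * `|Q| * `|x| * (n%:R * `|x|) + 1) => [|A].
  by rewrite ltr_wpDl// !mulr_ge0// exprn_ge0.
rewrite (le_trans (bform_bound _ _ _))//.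
rewrite (@le_trans _ _ (n%:R ^+ 2 * `|Q| * `|x| * (n%:R * `|x|) * `|A|))//.
  rewrite -[X in _ <= X]mulrA ler_wpM2l ?mulr_ge0// ?exprn_ge0//.
  by rewrite (le_trans (mx_normM _ _))// mulrAC.
by rewrite ler_wpM2r// lerDl.
Qed.

Lemma expmx_fix K x : K *m x = 0 -> expmx K *m x = x.
Proof.
move=> Kx; have [B -> _] := expmx_taylor2 K.
by rewrite !mulmxDl mul1mx -scalemxAl -!mulmxA Kx !mulmx0 scaler0 !addr0.
Qed.

Lemma expmx0 : expmx 0 = 1%:M :> 'M[R]_n.
Proof.
by have [B -> _] := @expmx_taylor2 R n 0; rewrite !mul0mx scaler0 !addr0.
Qed.

(* Convexity of t |-> Q(exp(tK) x), in a quantitative form for small K. *)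
Lemma qform_expmx_ge : exists2 r : R, 0 < r & forall K, adj K = K -> `|K| <= r ->
  forall x, qform Q x + 2 * bform Q x (K *m x) + qform Q (K *m x) <=
            qform Q (expmx K *m x).
Proof.
have [c c0 Qc] := posdef_coercive Qpd.
have n0 : 0 <= n%:R :> R by [].
pose M := n%:R ^+ 2 * `|Q|; pose b := n%:R * expR n%:R :> R.
have M0 : 0 <= M by rewrite mulr_ge0// exprn_ge0.
have b0 : 0 <= b by rewrite mulr_ge0// expR_ge0.
pose T := 2 * (M * (n%:R * b) + M * (n%:R + n%:R * (n%:R * b))).
have T0 : 0 <= T by rewrite mulr_ge0// addr_ge0// !mulr_ge0// addr_ge0// !mulr_ge0.
exists (Num.min 1 (c / (T + 1))) => [|K Ks].
  by rewrite lt_min ltr01 divr_gt0// ltr_wpDl.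
rewrite le_min => /andP[K1 KT] x.
have {}KT : T * `|K| <= c.
  move: KT; rewrite ler_pdivlMr ?ltr_wpDl// mulrDr mulr1; apply: le_trans.
  by rewrite mulrC lerDl.
have [B -> Ble] := expmx_taylor2 K.
have {}Ble : `|B| <= b * `|K|.
  apply: le_trans Ble _; rewrite /b [X in _ <= X]mulrAC ler_wpM2l ?mulr_ge0// ler_expR.
  by rewrite ler_piMr.
(* [expmx K] maps [x] to [x + y + v]. As [K] is self-adjoint, [2 Q(x, v)] contributes a second
   [Q(y)], which pays for the error terms once [K] is small. *)
pose y := K *m x; pose v := K *m (2^-1 *: y + B *m y).
have -> : (1%:M + K + 2^-1 *: (K *m K) + K *m B *m K) *m x = x + y + v.
  by rewrite !mulmxDl mul1mx /v mulmxDr -scalemxAl -scalemxAr -!mulmxA !addrA.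
have KC u w : bform Q u (K *m w) = bform Q (K *m u) w by rewrite bform_adjoint Ks.
have xv : bform Q x v = 2^-1 * qform Q y + bform Q y (B *m y).
  by rewrite /v KC -/y bformDr bformZr.
have bC u w : bform Q u w = bform Q w u by apply: bformC; exact: Qpd.1.
have yv : `|bform Q y v| <= M * (n%:R + n%:R * (n%:R * b)) * `|K| * `|y| ^+ 2.
  have vle : `|v| <= (n%:R + n%:R * (n%:R * b)) * `|K| * `|y|.
    rewrite (le_trans (mx_normM _ _))//.
    have -> : (n%:R + n%:R * (n%:R * b)) * `|K| * `|y| =
      n%:R * `|K| * (`|y| + n%:R * b * `|y|) by ring.
    rewrite ler_wpM2l ?mulr_ge0// (le_trans (ler_normD _ _))// lerD//.
      by rewrite normrZ ger0_norm// ler_piMl// invf_le1// ler1n.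
    rewrite (le_trans (mx_normM _ _))// ler_wpM2r// ler_wpM2l//.
    by rewrite (le_trans Ble)// ler_piMr.
  rewrite (le_trans (bform_bound _ _ _))//.
  have -> : M * (n%:R + n%:R * (n%:R * b)) * `|K| * `|y| ^+ 2 =
    M * `|y| * ((n%:R + n%:R * (n%:R * b)) * `|K| * `|y|) by ring.
  by rewrite ler_wpM2l ?mulr_ge0.
have yBy : `|bform Q y (B *m y)| <= M * (n%:R * b) * `|K| * `|y| ^+ 2.
  rewrite (le_trans (bform_bound _ _ _))//.
  have -> : M * (n%:R * b) * `|K| * `|y| ^+ 2 =
    M * `|y| * (n%:R * (b * `|K|) * `|y|) by ring.
  rewrite ler_wpM2l ?mulr_ge0// (le_trans (mx_normM _ _))//.
  by rewrite ler_wpM2r// ler_wpM2l.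
have small : 2 * (`|bform Q y (B *m y)| + `|bform Q y v|) <= qform Q y.
  apply: le_trans (Qc y); apply: le_trans (ler_wpM2r _ KT); last by rewrite exprn_ge0.
  have -> : T * `|K| * `|y| ^+ 2 = 2 * (M * (n%:R * b) * `|K| * `|y| ^+ 2 +
    M * (n%:R + n%:R * (n%:R * b)) * `|K| * `|y| ^+ 2) by rewrite /T; ring.
  by rewrite ler_wpM2l// lerD.
have qv : 0 <= qform Q v by exact: posdef_qform_ge0.
have -> : qform Q (x + y + v) = qform Q x + 2 * bform Q x y + qform Q y +
    2 * bform Q x v + 2 * bform Q y v + qform Q v.
  by rewrite /qform !bformDl !bformDr (bC y x) (bC v x) (bC v y); ring.
rewrite xv -/y.
have := ler_norm (- bform Q y (B *m y)); have := ler_norm (- bform Q y v).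
rewrite !normrN; lra.
Qed.

(** Up to a small error [D] is [(q - 1) / |q - 1|]; self-adjointness and the sign of
    [Q(x, (q - 1) x)] survive because both are expressed by bounded linear maps. *)
Lemma limit_direction_selfadjoint (G C : set 'M[R]_n) :
  closed_linear_group G -> C `<=` G -> (forall q, C q -> adj q = q) ->
  (forall e : R, 0 < e -> exists2 q, C q & 0 < `|q - 1%:M| < e) ->
  exists D, [/\ lie_algebra G D /\ adj D = D, `|D| = 1,
    forall x, (forall q, C q -> qform Q x <= bform Q x (q *m x)) ->
      0 <= bform Q x (D *m x) &
    forall e : R, 0 < e -> exists q,
    [/\ C q, 0 < `|q - 1%:M| < e & `|q - 1%:M - `|q - 1%:M| *: D| <= e * `|q - 1%:M|]].
Proof.
move=> GG CG Cadj acc; have [D [GD D1 Dlim]] := limit_direction GG CG acc.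
exists D; split=> //; first split=> //.
  have [c c1 cadj] := adjoint_bound.
  apply/eqP; rewrite -subr_eq0 -normr_le0; apply/ler_addgt0Pr => e e0; rewrite add0r.
  have c0 : 0 < 1 + c by rewrite ltr_pwDl// (le_trans ler01).
  have [q [Cq /andP[a0 _] ple]] := Dlim _ (divr_gt0 e0 c0).
  set a := `|q - _| in a0 ple; set p := q - 1%:M - _ in ple.
  have E : a *: (adj D - D) = p - adj p.
    rewrite /p !adjointD !adjointN adjointZ adjoint1 (Cadj q Cq) scalerBr.
    by apply/matrixP => i j; rewrite !mxE; ring.
  rewrite -(ler_pM2l a0) -[X in X * _ <= _](gtr0_norm a0) -normrZ E.
  rewrite (le_trans (ler_normB _ _))//.
  rewrite (le_trans (lerD (lexx _) (cadj p)))//.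
  rewrite -[X in X + _]mul1r -mulrDl (le_trans (ler_wpM2l (ltW c0) ple))//.
  by rewrite mulrA [_ * (e / _)]mulrC divfK ?gt_eqF// mulrC.
move=> x Cx; have [c c0 cb] := bform_mul_bound x.
rewrite -oppr_le0; apply/ler_addgt0Pr => e e0; rewrite add0r.
have [q [Cq /andP[a0 _] ple]] := Dlim _ (divr_gt0 e0 c0).
set a := `|q - _| in a0 ple; set p := q - 1%:M - _ in ple.
have E : a * - bform Q x (D *m x) = bform Q x (p *m x) - (bform Q x (q *m x) - qform Q x).
  rewrite /p !mulmxBl !bformBr mul1mx -scalemxAl bformZr /qform; ring.
rewrite -(ler_pM2l a0) E.
rewrite (@le_trans _ _ (bform Q x (p *m x)))//.
  by rewrite gerBl subr_ge0 Cx.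
rewrite (le_trans (ler_norm _))// (le_trans (cb p))//.
rewrite (le_trans (ler_wpM2l (ltW c0) ple))//.
by rewrite mulrA [_ * (e / _)]mulrC divfK ?gt_eqF// mulrC.
Qed.

End SelfAdjoint.

(** * Neighbourhoods and rays in matrix spaces *)

Section Rays.
Variables (R : realType) (m n : nat).
Implicit Types K H : 'M[R]_(m, n).

Lemma nbhs_ray K H (U : set 'M[R]_(m, n)) : nbhs K U ->
  exists2 s : R, 0 < s & U (K + s *: H).
Proof.
move=> /(@nbhs_ballP _ 'M[R]_(m, n))[e /= e0 eU].
have h0 : 0 < `|H| + 1 by rewrite ltr_wpDl.
exists (e / 2 / (`|H| + 1)); first by rewrite !divr_gt0.
apply: eU; rewrite -ball_normE /= opprD addrA subrr add0r normrN normrZ.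
rewrite ger0_norm ?divr_ge0 ?ltW// ?divr_gt0//.
rewrite (@le_lt_trans _ _ (e / 2 / (`|H| + 1) * (`|H| + 1)))//.
  by rewrite ler_wpM2l ?lerDl// ltW// !divr_gt0.
by rewrite divfK ?gt_eqF// ltr_pdivrMr// ltr_pMr// ltr1n.
Qed.

Lemma not_near_ex K (P : set 'M[R]_(m, n)) : ~ (\forall M \near K, P M) ->
  forall e : R, 0 < e -> exists2 M, `|M - K| < e & ~ P M.
Proof.
move=> nP e e0; apply: contrapT => noM; apply: nP.
apply/(@nbhs_ballP _ 'M[R]_(m, n)); exists e => //= M.
rewrite -ball_normE /= distrC => MK; apply: contrapT => nPM.
by apply: noM; exists M.
Qed.

Lemma near0_norm_le (r : R) : 0 < r -> \forall K \near (0 : 'M[R]_(m, n)), `|K| <= r.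
Proof.
move=> r0; apply/(@nbhs_ballP _ 'M[R]_(m, n)); exists r => //= K.
by rewrite -ball_normE /= sub0r normrN => /ltW.
Qed.

End Rays.

Lemma near_finite_set (T : Type) (I : eqType) (F : set_system T) {FF : Filter F} (A : set I)
    (P : I -> T -> Prop) : finite_set A ->
  (forall i, A i -> \forall x \near F, P i x) -> \forall x \near F, forall i, A i -> P i x.
Proof.
case/finite_seqP => s ->; elim: s => [_|a s IH P_near]; first by apply: nearW => x i.
have sub i : i \in s -> i \in a :: s by move=> si; rewrite inE si orbT.
have : \forall x \near F, P a x by apply: P_near; rewrite /= inE eqxx.
have : \forall x \near F, forall i, [set` s] i -> P i x.
  by apply: IH => i /sub; exact: P_near.
apply: filterS2 => x Ps Pa i; rewrite /= inE => /predU1P[->//|]; exact: Ps.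
Qed.

(** * Voronoi spaces around a fixed form [Q] *)

Section VoronoiSpace.
Variables (R : realType) (n : nat) (QQ : set 'M[R]_n) (Z : set 'cV[R]_n).
Variables (G : set 'M[R]_n) (Q : 'M[R]_n).
Hypotheses (vs : voronoi_space QQ Z G) (QQQ : QQ Q).
Implicit Types (P g H K D q : 'M[R]_n) (x y : 'cV[R]_n) (X Y : set 'cV[R]_n).

Local Notation adj := (adjoint Q).

Let Qpd : posdef Q := vs_posdef vs QQQ.
Let GG : closed_linear_group G := vs_group vs.

(** If [Z] were empty, spanning would force [V = 0]; then [2 Q = Q], against condition (i). *)
Lemma voronoi_Z_neq0 : Z !=set0.
Proof.
apply: contrapT => Z0.
have v0 (v : 'cV[R]_n) : v = 0.
  have [s sZ] := vs_span vs v; case: s sZ => [|x s] sZ; last first.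
    by exfalso; apply: Z0; exists x; apply: sZ; rewrite inE eqxx.
  by rewrite span_nil memv0 => /eqP.
have QE : 2 *: Q = Q by apply: bform_inj => x y; rewrite (v0 y) !bform0r.
have := @vs_scale _ _ _ _ _ vs Q 2 QQQ (ltr0n _ 2); rewrite QE => /(_ QQQ) h.
by move: (ltr1n R 2); rewrite h ltxx.
Qed.

Let Zne := voronoi_Z_neq0.

Lemma G_adjoint g : G g -> G (adj g).
Proof. by move=> Gg; exact: (vs_adjoint vs). Qed.

Lemma lie_algebra_expmx K : lie_algebra G K -> G (expmx K).
Proof. by move=> /(_ 1); rewrite scale1r. Qed.

Lemma lie_algebra0 : lie_algebra G 0.
Proof. by move=> t; rewrite scaler0 expmx0; exact: clg_one GG. Qed.

Lemma QQ_expmx K : lie_algebra G K -> QQ (pullback Q (expmx K)).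
Proof. by move=> GK; apply: (vs_act vs) => //; exact: lie_algebra_expmx. Qed.

Lemma qform_pullback g x : qform (pullback Q g) x = qform Q (g *m x).
Proof. exact: bform_pullback. Qed.

Lemma pullback_expmx_cvg : (fun K => pullback Q (expmx K)) @ (0 : 'M[R]_n) --> Q.
Proof.
have e1 : @expmx R n @ nbhs (0 : 'M[R]_n) --> (1%:M : 'M[R]_n).
  by rewrite -(expmx0 R n); exact: expmx_continuous.
suff : (fun K => (expmx K)^T *m Q *m expmx K) @ nbhs (0 : 'M[R]_n) -->
    1%:M^T *m Q *m 1%:M by rewrite trmx1 mul1mx mulmx1.
apply: cvg_mulmx => //; apply: (@cvg_mulmxr _ _ (nbhs (0 : 'M[R]_n))).
exact: (@cvg_trmx _ _ (nbhs (0 : 'M[R]_n))).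
Qed.

Lemma near_pullback_expmx (S : set 'M[R]_n) : (\forall P \near Q, S P) ->
  \forall K \near (0 : 'M[R]_n), S (pullback Q (expmx K)).
Proof. exact: pullback_expmx_cvg. Qed.

Lemma Qmin_expmx : \forall K \near (0 : 'M[R]_n), lie_algebra G K ->
  exists2 x, Qmin Z Q x & qform Q (expmx K *m x) = hermite Z (pullback Q (expmx K)).
Proof.
apply: filterS (near_pullback_expmx (hermite_near (vs_closed vs)
  (vs_discrete vs) (vs_neq0 vs) Zne Qpd)) => K HK GK.
have [x xQ <-] := HK (vs_posdef vs (QQ_expmx GK)).
by exists x => //; rewrite qform_pullback.
Qed.

Lemma bform_eq0_of_eutactic X D : eutactic G Q X -> lie_algebra G D ->
  (forall x, X x -> 0 <= bform Q x (D *m x)) -> forall x, X x -> bform Q x (D *m x) = 0.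
Proof.
move=> eut GD Dge x Xx; apply/eqP; rewrite eq_le Dge// andbT leNgt; apply/negP => Dx.
by have [|y Xy] := eut D GD; [exists x|rewrite ltNge Dge].
Qed.

(** * Necessity: from local maxima to eutaxy and perfection *)

Lemma selfadjoint_eutactic X Y : X !=set0 -> X `<=` Qmin Z Q -> X `<=` Y ->
  (forall H, lie_algebra G H -> adj H = H -> (forall x, X x -> 0 <= bform Q x (H *m x)) ->
     forall y, Y y -> H *m y = 0) ->
  eutactic G Q X /\ forall H (c : R), lie_algebra G H ->
    (forall x, X x -> bform Q x (H *m x) = c * qform Q x) ->
    forall y, Y y -> H *m y + adj H *m y = (2 * c) *: y.
Proof.
(* Shared by both cases: [Y = setT] will give perfection and [Y = X] weak perfection. Both
   conclusions see [H] only through its self-adjoint part, to which [W] applies. *)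
move=> [x0 Xx0] XQ XY W.
have W' H : lie_algebra G H -> (forall x, X x -> 0 <= bform Q x (H *m x)) ->
    forall y, Y y -> sympart Q H *m y = 0.
  move=> GH HX; apply: W.
  - exact: (lie_algebra_sympart Qpd GG G_adjoint).
  - exact: adjoint_sympart.
  - by move=> x Xx; rewrite bform_sympart// HX.
split=> [H GH [x Xx Hx]|H c GH Hc].
  apply: contrapT => noy; move: Hx; rewrite -bform_sympart// W' ?bform0r ?ltxx//.
    move=> y Xy; rewrite leNgt; apply/negP => Hy.
    by apply: noy; exists y.
  exact: XY.
have Qx0 x : X x -> 0 < qform Q x.
  move=> Xx; have [_ ->] := XQ x Xx.
  exact: (hermite_gt0 (vs_closed vs) (vs_discrete vs) (vs_neq0 vs) Zne Qpd).
(* According to the sign of [c], one of [H] and [- H] is nonnegative on [X]; so the self-adjoint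
   part vanishes on [Y], and then [c] must be [0]. *)
have S0 y : Y y -> sympart Q H *m y = 0.
  have [c0|c0] := leP 0 c.
    by apply: W' => // x Xx; rewrite Hc// mulr_ge0// ltW// Qx0.
  move=> Yy; have : sympart Q (- H) *m y = 0.
    apply: W' => // [|x Xx]; first by rewrite -scaleN1r; exact: lie_algebraZ.
    by rewrite mulNmx -scaleN1r bformZr mulN1r Hc// oppr_ge0 ltW// pmulr_llt0// Qx0.
  by rewrite /sympart adjointN// -opprD scalerN mulNmx => /eqP; rewrite oppr_eq0 => /eqP.
have c0 : c = 0.
  have := Hc x0 Xx0; rewrite -bform_sympart// S0 ?bform0r//; last exact: XY.
  by move/esym/eqP; rewrite mulf_eq0 (gt_eqF (Qx0 x0 Xx0)) orbF => /eqP.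
move=> y Yy; rewrite c0 mulr0 scale0r -mulmxDl.
have := S0 y Yy; rewrite /sympart -scalemxAl => /eqP.
by rewrite scaler_eq0 invr_eq0 pnatr_eq0 /= => /eqP.
Qed.

(** By convexity [gamma] does not drop along a small [K] that is nonnegative on the minimal vectors,
    so strictness forces [pullback Q (expmx K) = Q]. The convexity inequality then reads
    [2 Q(y, K y) + Q(K y) <= 0] for every [y]; it also holds for [- K], and adding the two gives
    [K y = 0]. *)
Lemma strictly_extreme_perfect : strictly_extreme QQ Z Q ->
  perfect G Q (Qmin Z Q) /\ eutactic G Q (Qmin Z Q).
Proof.
move=> ext; have [r r0 HSO] := qform_expmx_ge Qpd.
have [||//|H GH Hadj HX|eut perf] := @selfadjoint_eutactic (Qmin Z Q) setT.
- exact: (Qmin_neq0 (vs_closed vs) (vs_discrete vs) Zne Qpd).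
- by [].
- have key : \forall K \near (0 : 'M[R]_n), lie_algebra G K -> adj K = K ->
      (forall x, Qmin Z Q x -> 0 <= bform Q x (K *m x)) ->
      forall y, 2 * bform Q y (K *m y) + qform Q (K *m y) <= 0.
    apply: filterS3 (near0_norm_le _ _ r0) Qmin_expmx (near_pullback_expmx ext).
    move=> K Kr KQ Kext GK Kadj KX y; have SO := HSO K Kadj Kr.
    have PQ : pullback Q (expmx K) = Q.
      apply/eqP; apply: contrapT => /negP PnQ.
      have := Kext (QQ_expmx GK) PnQ; have [x xQ <-] := KQ GK.
      have [_ <-] := xQ; rewrite ltNge => /negP; apply; apply: le_trans (SO x).
      by rewrite -addrA lerDl addr_ge0 ?mulr_ge0 ?KX// posdef_qform_ge0.
    by have := SO y; rewrite -(qform_pullback (expmx K)) PQ; lra.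
  have keyN : \forall K \near (0 : 'M[R]_n), lie_algebra G (- K) -> adj (- K) = - K ->
      (forall x, Qmin Z Q x -> 0 <= bform Q x (- K *m x)) ->
      forall y, 2 * bform Q y (- K *m y) + qform Q (- K *m y) <= 0.
    have : (@GRing.opp 'M[R]_n) @ nbhs (0 : 'M[R]_n) --> (0 : 'M[R]_n).
      by rewrite -[X in _ --> X]oppr0; apply: cvgN; exact: cvg_id.
    by move=> /(_ _ key).
  have [s s0] := @nbhs_ray _ _ _ 0 H _ (filterI key keyN).
  rewrite add0r; set K := s *: H => -[HK HNK] y _.
  have GK : lie_algebra G K by exact: lie_algebraZ.
  have Kadj : adj K = K by rewrite adjointZ// Hadj.
  have KX x : Qmin Z Q x -> 0 <= bform Q x (K *m x).
    by move=> xQ; rewrite -scalemxAl bformZr mulr_ge0 ?HX// ltW.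
  have {}HK := HK GK Kadj KX.
  (* On minimal vectors the inequality gives [K x = 0], which makes [- K] admissible in it too. *)
  have KX0 x : Qmin Z Q x -> K *m x = 0.
    move=> xQ; apply/eqP; apply: contrapT => /negP /(Qpd.2) Kx.
    have := HK x; have := KX x xQ; move: Kx; lra.
  have HN : 2 * bform Q y (- K *m y) + qform Q (- K *m y) <= 0.
    apply: HNK; first by rewrite -scaleN1r; exact: lie_algebraZ.
      by rewrite adjointN// Kadj.
    by move=> x xQ; rewrite mulNmx KX0// oppr0 bform0r.
  have NK : - K *m y = -1 *: (K *m y) by rewrite mulNmx scaleN1r.
  move: HN; rewrite NK /qform bformZl !bformZr => HN.
  have Ky : K *m y = 0.
    apply/eqP; apply: contrapT => /negP /(Qpd.2) Kx.
    have := HK y; move: Kx HN; rewrite /qform; lra.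
  by move: Ky; rewrite -scalemxAl => /eqP; rewrite scaler_eq0 gt_eqF//= => /eqP.
split=> // H c GH Hc.
have HV y : (H + adj H) *m y = (2 * c)%:M *m y.
  by rewrite mulmxDl (perf H c)// mul_scalar_mx.
by apply: bform_inj => x y; rewrite /bform -!mulmxA HV.
Qed.

Lemma near_expmx_gt K x (a : R) : a < qform Q (expmx K *m x) ->
  \forall L \near K, a < qform Q (expmx L *m x).
Proof.
move=> aK; have : (fun L => qform Q (expmx L *m x)) @ nbhs K --> qform Q (expmx K *m x).
  apply: (@continuous_cvg _ _ _ (nbhs K) _ (fun L => expmx L *m x) (qform Q)).
    exact: qform_continuous.
  by apply: (@cvg_mulmxr _ _ (nbhs K)); exact: expmx_continuous.
by move=> /cvgr_gt; apply.
Qed.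

Lemma extreme_weakly_perfect : extreme QQ Z Q -> exists X : set 'cV[R]_n,
  [/\ X !=set0, X `<=` Qmin Z Q, weakly_perfect G Q X & eutactic G Q X].
Proof.
move=> ext; have [r r0 HSO] := qform_expmx_ge Qpd.
have Qfin := Qmin_finite (vs_closed vs) (vs_discrete vs) Qpd.
(* Arbitrarily small [K] are asked for, so that [ext] can be applied to [pullback Q (expmx K)]. *)
pose good X := forall U, nbhs (0 : 'M[R]_n) U -> exists K,
  [/\ U K, lie_algebra G K /\ adj K = K, forall x, X x -> K *m x = 0 &
     forall x, Qmin Z Q x -> ~ X x -> qform Q x < qform Q (expmx K *m x)].
have goodQ : good (Qmin Z Q).
  move=> U U0; exists 0; split=> //; first exact: nbhs_singleton U0.
    by split; [exact: lie_algebra0|rewrite -(scale0r 0) adjointZ// !scale0r].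
  by move=> x _; rewrite mul0mx.
have [X [XQ goodX Xmin]] := finite_set_minimal Qfin goodQ.
(* If [X] were empty, some small [K] would increase [Q] on every minimal vector, hence [gamma]. *)
have X0 : X !=set0.
  have [K [[KQ Kext] [GK _] _ KX]] := goodX _ (filterI Qmin_expmx (near_pullback_expmx ext)).
  have [x xQ xh] := KQ GK; apply: contrapT => X0.
  have := Kext (QQ_expmx GK); rewrite -xh; have [_ <-] := xQ.
  by rewrite leNgt KX// => Xx; apply: X0; exists x.
have [//|H GH Hadj HX|eut wp] := @selfadjoint_eutactic X X X0 XQ; last first.
  by exists X; split.
(* By minimality it suffices that the vectors of [X] killed by [H] form a good set: [K + s H] raises
   the other vectors of [X] by convexity, and a small [s] keeps the strict increase outside [X]. *)
suff -> : X = [set x | X x /\ H *m x = 0] by move=> y [].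
apply/esym/Xmin => [x []//|U U0].
(* An open [V] leaves room around [K] itself, not only around [0]. *)
have [V [Vo V0] VU] : exists2 V, open_nbhs (0 : 'M[R]_n) V &
    V `<=` U `&` [set K | `|K| <= r].
  exists (U `&` [set K | `|K| <= r])°; last exact: interior_subset.
  by split; [exact: open_interior|exact: filterI U0 (near0_norm_le _ _ r0)].
have [K [VK [GK Kadj] KX KQ]] := goodX V (open_nbhs_nbhs (conj Vo V0)).
have nearK : \forall L \near K, forall x, (Qmin Z Q `&` ~` X) x ->
    qform Q x < qform Q (expmx L *m x).
  apply: (@near_finite_set _ _ (nbhs K)) => [|x [xQ nXx]].
    by apply: sub_finite_set Qfin => x [].
  by apply: near_expmx_gt; exact: KQ.
have [s s0 [VL LQ]] := @nbhs_ray _ _ _ K H _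
  (filterI (open_nbhs_nbhs (conj Vo VK)) nearK).
set L := K + s *: H in VL LQ; have [UL Lr] := VU L VL.
have Ladj : adj L = L by rewrite adjointD// adjointZ// Hadj Kadj.
exists L; split=> //.
- by split=> //; apply: lie_algebraD => //; exact: lie_algebraZ.
- by move=> x [Xx Hx]; rewrite mulmxDl -scalemxAl Hx KX// scaler0 addr0.
move=> x xQ nx; have [Xx|nXx] := pselect (X x); last by apply: LQ.
have Lx : L *m x = s *: (H *m x) by rewrite mulmxDl KX// add0r -scalemxAl.
apply: lt_le_trans (HSO L Ladj Lr x); rewrite -addrA ltrDl.
rewrite Lx bformZr ltr_wpDl//; first by rewrite !mulr_ge0 ?HX// ltW.
apply: Qpd.2; rewrite scaler_eq0 gt_eqF//=; apply/eqP => Hx.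
by apply: nx.
Qed.

(** * Sufficiency: from perfection and eutaxy to local maxima *)

Lemma QQ_quotient P : QQ P ->
  [/\ G (invmx Q *m P), adj (invmx Q *m P) = invmx Q *m P &
    forall x, bform Q x (invmx Q *m P *m x) = qform P x].
Proof.
move=> QQP; have [g Gg Pg] := vs_trans vs QQQ QQP.
have Qu := posdef_unitmx Qpd; have [Psym _] := vs_posdef vs QQP.
(* This is the [p] attached to [P], written without a choice of [g]; the form [adj g *m g] shows
   that it is self-adjoint and lies in [G]. *)
have -> : invmx Q *m P = adj g *m g by rewrite Pg /pullback adjointE// !mulmxA.
split.
- by apply: (clg_mul GG) => //; exact: G_adjoint.
- by rewrite adjointM// adjointK.
move=> x; rewrite -mulmxA bform_adjoint// adjointK// Pg.
by rewrite qform_pullback.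
Qed.

Lemma QQ_quotient_norm : exists2 c : R, 0 < c &
  forall P, `|invmx Q *m P - 1%:M| <= c * `|P - Q|.
Proof.
exists (n%:R * `|invmx Q| + 1) => [|P]; first by rewrite ltr_wpDl// mulr_ge0.
rewrite -{1}(mulVmx (posdef_unitmx Qpd)) -mulmxBr (le_trans (mx_normM _ _))//.
by rewrite ler_wpM2r// lerDl.
Qed.

Lemma perfect_eutactic_strictly_extreme :
  perfect G Q (Qmin Z Q) -> eutactic G Q (Qmin Z Q) -> strictly_extreme QQ Z Q.
Proof.
move=> perf eut; apply: contrapT => nse.
have [c c0 cP] := QQ_quotient_norm; have Qu := posdef_unitmx Qpd.
(* The quotients of the counterexamples to strict extremality; they accumulate at [1]. *)
pose C := [set q | exists P, [/\ QQ P, P <> Q, hermite Z Q <= hermite Z P &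
  q = invmx Q *m P]].
have [|||D [[GD Dadj] D1 Dge _]] := @limit_direction_selfadjoint _ _ Q Qpd G C GG.
- by move=> _ [P [QQP _ _ ->]]; have [] := QQ_quotient QQP.
- by move=> _ [P [QQP _ _ ->]]; have [] := QQ_quotient QQP.
- move=> e e0; have [P PQe] := not_near_ex nse (divr_gt0 e0 c0).
  move=> /not_implyP[QQP /not_implyP[/eqP PQ /negP hP]].
  rewrite -leNgt in hP.
  exists (invmx Q *m P); first by exists P.
  apply/andP; split.
    rewrite normr_gt0 subr_eq0; apply/eqP => QP1; apply: PQ.
    by rewrite -(mulKVmx Qu P) QP1 mulmx1.
  by apply: le_lt_trans (cP P) _; rewrite mulrC -ltr_pdivlMr.
have Dge0 x : Qmin Z Q x -> 0 <= bform Q x (D *m x).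
  move=> [Zx xh]; apply: Dge => _ [P [QQP _ hP ->]].
  have [_ _ ->] := QQ_quotient QQP; rewrite xh (le_trans hP)//.
  exact: (hermite_le (vs_closed vs) (vs_discrete vs) Zne (vs_posdef vs QQP) Zx).
have D0 := bform_eq0_of_eutactic eut GD Dge0.
(* Perfection with [c = 0] gives [2 D = 0], against [|D| = 1]. *)
have := perf D 0 GD; rewrite Dadj mulr0 => DD.
have /eqP : D + D = 0.
  by rewrite DD ?raddf0// => x Qx; rewrite D0// mul0r.
rewrite -mulr2n -scaler_nat scaler_eq0 pnatr_eq0 /= => /eqP D00.
by move: D1; rewrite D00 normr0 => /esym/eqP; rewrite oner_eq0.
Qed.

(* Replacing q by m^* q m with m fixing X pointwise does not change Q(x, q x) on
   X, so q may be taken almost closest to 1 in its class; a limiting direction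
   D of such q kills X, and m = exp(- |q - 1| D / 4) brings q strictly closer. *)
Lemma weakly_perfect_eutactic_extreme X : X !=set0 -> X `<=` Qmin Z Q ->
  weakly_perfect G Q X -> eutactic G Q X -> extreme QQ Z Q.
Proof.
move=> [x0 Xx0] XQ wp eut; apply: contrapT => nex.
have [c c0 cP] := QQ_quotient_norm.
pose N := [set m | G m /\ forall x, X x -> m *m x = x].
pose f q m := `|adj m *m q *m m - 1%:M|.
have bform_conj q m x : N m -> X x ->
    bform Q x (adj m *m q *m m *m x) = bform Q x (q *m x).
  by move=> [_ mX] Xx; rewrite -!mulmxA bform_adjoint// adjointK// mX.
(* The infimum over [m] need not be attained, so [q] is only almost closest to [1]; any factor
   strictly between the [5 / 8] reached at the end and [1] could replace [3 / 4]. *)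
pose C := [set q | [/\ G q, adj q = q,
  forall x, X x -> qform Q x < bform Q x (q *m x) &
  forall m, N m -> 3 / 4 * `|q - 1%:M| <= f q m]].
have N1 : N 1%:M by split=> [|x _]; [exact: clg_one GG|rewrite mul1mx].
have [|||D [[GD Dadj] D1 Dge Dlim]] := @limit_direction_selfadjoint _ _ Q Qpd G C GG.
- by move=> q [].
- by move=> q [].
- move=> e e0.
  (* A minimiser up to the factor [4 / 3] is at distance less than [4 / 3 * c * |P - Q|] from [1],
     since [m = 1] competes. *)
  have e'0 : 0 < e / (4 / 3 * c) by rewrite divr_gt0// mulr_gt0// divr_gt0.
  have [P PQe /not_implyP[QQP /negP]] := not_near_ex nex e'0.
  rewrite -ltNge => hP.
  have [Gp padj pP] := QQ_quotient QQP; have := cP P.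
  move: (invmx Q *m P) Gp padj pP => p Gp padj pP p1.
  have pX x : X x -> qform Q x < bform Q x (p *m x).
    move=> Xx; have [Zx ->] := XQ x Xx; rewrite pP (lt_le_trans hP)//.
    exact: (hermite_le (vs_closed vs) (vs_discrete vs) Zne (vs_posdef vs QQP) Zx).
  have [b b0 bx0] := bform_mul_bound Q x0.
  (* [Q(x0, q x0) - Q(x0)] is positive and constant on the class of [p], so the whole class stays at
     distance at least [d0] from [1] and the infimum is positive. *)
  pose d0 := (bform Q x0 (p *m x0) - qform Q x0) / b.
  have d0gt : 0 < d0 by rewrite divr_gt0// subr_gt0 pX.
  have d0le m : N m -> d0 <= f p m.
    move=> Nm; rewrite ler_pdivrMr// mulrC (le_trans _ (bx0 _))//.
    rewrite mulmxBl bformBr bform_conj// mul1mx (le_trans _ (ler_norm _))//.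
  pose F := [set f p m | m in N]; have F0 : F !=set0 by exists (f p 1%:M), 1%:M.
  have Flb : has_lbound F by exists d0 => _ [m Nm <-]; exact: d0le.
  have infF : d0 <= inf F by apply: lb_le_inf => // _ [m Nm <-]; exact: d0le.
  have infF0 : 0 < inf F := lt_le_trans d0gt infF.
  have infle m : N m -> inf F <= f p m by move=> Nm; apply: ge_inf => //; exists m.
  have [_ [m Nm <-] mlt] := inf_adherent (divr_gt0 infF0 (ltr0n R 3)) (conj F0 Flb).
  exists (adj m *m p *m m); last first.
    rewrite -/(f p m) (lt_le_trans infF0 (infle m Nm))/=.
    have f1 : f p 1%:M <= c * `|P - Q|.
      by rewrite /f adjoint1// mul1mx mulmx1.
    move: PQe; rewrite ltr_pdivlMr ?mulr_gt0 ?divr_gt0//.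
    have := infle _ N1; lra.
  have [Gm mX] := Nm; split.
  + by apply: (clg_mul GG) => //; apply: (clg_mul GG) => //; exact: G_adjoint.
  + by rewrite !adjointM// adjointK// padj mulmxA.
  + by move=> x Xx; rewrite bform_conj// pX.
  (* [N] is stable under products, so [m *m m'] competes in the same infimum. *)
  move=> m' [Gm' m'X]; rewrite -/(f p m).
  have -> : f (adj m *m p *m m) m' = f p (m *m m').
    by rewrite /f adjointM// !mulmxA.
  have := infle (m *m m'); rewrite -/(f p m) => inf'.
  have {}inf' : inf F <= f p (m *m m').
    apply: inf'; split=> [|x Xx]; first exact: (clg_mul GG).
    by rewrite -mulmxA m'X// mX.
  lra.
have Dge0 x : X x -> 0 <= bform Q x (D *m x).
  by move=> Xx; apply: Dge => q [_ _ qX _]; exact/ltW/qX.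
have D0 := bform_eq0_of_eutactic eut GD Dge0.
have DX x : X x -> D *m x = 0.
  move=> Xx; have := @wp D 0 GD _ x Xx; rewrite Dadj mulr0 scale0r => DD.
  have /eqP : D *m x + D *m x = 0 by apply: DD => y Xy; rewrite D0// mul0r.
  by rewrite -mulr2n -scaler_nat scaler_eq0 pnatr_eq0 /= => /eqP.
have [t t0 exp1] := expmx_taylor1 R n; have [A A1 adjA] := adjoint_bound Qpd.
have n0 : 0 <= n%:R :> R by [].
have A0 : 0 <= A := le_trans ler01 A1.
(* Total coefficient of [a ^+ 2] in the error terms below; [e] is chosen so that
   [(1 + T) e = 1 / 8]. *)
pose T := n%:R * A + n%:R + n%:R * A + n%:R ^+ 2 * A + (1 + A) * t.
have tT : t <= T.
  rewrite /T mulrDl mul1r addrA addrAC lerDr ?addr_ge0// !mulr_ge0// ?exprn_ge0//.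
  exact: ltW.
have T0 : 0 < T := lt_le_trans t0 tT.
have e0 : 0 < (8 * (1 + T))^-1 by rewrite invr_gt0 mulr_gt0// addr_gt0.
have [q [[Gq qadj _ qmin] /andP[a0 ae] qD]] := Dlim _ e0.
set e := (8 * (1 + T))^-1 in e0 ae qD.
have eT : e * (8 * (1 + T)) = 1 by rewrite mulVf// gt_eqF// mulr_gt0// addr_gt0.
set w := q - 1%:M in a0 ae qD qmin; set a := `|w| in a0 ae qD qmin.
have a1 : a <= 1 by nra.
have at1 : a * t <= 1 by nra.
(* To first order [m] and its adjoint each contribute [- (a / 4) D], which cancels half of the [a D]
   in [q - 1]. *)
pose K := (- (a / 4)) *: D; pose m := expmx K.
have nK : `|K| = a / 4 by rewrite normrZ D1 mulr1 normrN gtr0_norm// divr_gt0.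
have Nm : N m.
  split=> [|x Xx]; first by apply/lie_algebra_expmx; exact: lie_algebraZ.
  by apply: expmx_fix; rewrite -scalemxAl DX// scaler0.
have := qmin m Nm; apply/negP; rewrite -ltNge.
pose v := m - 1%:M - K.
have vle : `|v| <= t * (a / 4) ^+ 2.
  by rewrite -nK; apply: exp1; rewrite nK; lra.
pose u := m - 1%:M.
have uE : u = K + v by rewrite /v addrC subrK.
have Kadj : adj K = K by rewrite adjointZ// Dadj.
have ule : `|u| <= a.
  rewrite uE (le_trans (ler_normD _ _))// nK; move: vle.
  have : t * (a / 4) ^+ 2 <= a / 16 by rewrite expr2; nra.
  lra.
have uale : `|adj u| <= A * a by rewrite (le_trans (adjA u))// ler_wpM2l.
have mE : m = 1%:M + u by rewrite addrC subrK.
have qE : q = 1%:M + w by rewrite addrC subrK.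
have expand (z1 z2 z3 : 'M[R]_n) :
    (1%:M + z1) *m (1%:M + z2) *m (1%:M + z3) - 1%:M = z3 + z1 + z2 +
    (z1 *m z2 + z2 *m z3 + z1 *m z3 + z1 *m z2 *m z3).
  rewrite !(mulmxDl, mulmxDr, mul1mx, mulmx1).
  move: (z1 *m z2 *m z3) (z1 *m z2) (z1 *m z3) (z2 *m z3) => y1 y2 y3 y4.
  by apply/matrixP => i j; rewrite !mxE; ring.
have E : adj m *m q *m m - 1%:M = (2^-1 * a) *: D + (w - a *: D) + (v + adj v) +
    (adj u *m w + w *m u + adj u *m u + adj u *m w *m u).
  rewrite mE qE adjointD// adjoint1//.
  rewrite expand.
  congr (_ + _); rewrite uE adjointD// Kadj /K.
  by apply/matrixP => i j; rewrite !mxE; field.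
have Mle (M1 M2 : 'M[R]_n) (b1 b2 : R) : `|M1| <= b1 -> `|M2| <= b2 ->
    `|M1 *m M2| <= n%:R * (b1 * b2).
  move=> h1 h2; rewrite (le_trans (mx_normM _ _))// -mulrA ler_wpM2l//.
  by rewrite ler_pM.
have l1 : `|adj u *m w| <= n%:R * (A * a * a) by apply: Mle.
have l2 : `|w *m u| <= n%:R * (a * a) by apply: Mle.
have l3 : `|adj u *m u| <= n%:R * (A * a * a) by apply: Mle.
have l4 : `|adj u *m w *m u| <= n%:R * (n%:R * (A * a * a) * a) by apply: Mle.
have l4' : n%:R * (n%:R * (A * a * a) * a) <= n%:R ^+ 2 * A * a ^+ 2.
  rewrite [X in X <= _](_ : _ = n%:R ^+ 2 * A * a ^+ 2 * a); last by ring.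
  by rewrite ler_piMr// !mulr_ge0// ?exprn_ge0// ltW.
have l5 : `|v + adj v| <= (1 + A) * t * a ^+ 2.
  rewrite (le_trans (ler_normD _ _))// (le_trans (lerD (lexx _) (adjA v)))//.
  rewrite -[X in X + _]mul1r -mulrDl -mulrA ler_wpM2l ?addr_ge0// (le_trans vle)//.
  by rewrite ler_wpM2l ?(ltW t0)// lerXn2r ?nnegrE ?divr_ge0 ?(ltW a0)//; lra.
have l6 : `|(2^-1 * a) *: D| <= 2^-1 * a.
  by rewrite normrZ D1 mulr1 gtr0_norm// mulr_gt0.
have Dle (M1 M2 : 'M[R]_n) (b1 b2 : R) : `|M1| <= b1 -> `|M2| <= b2 ->
    `|M1 + M2| <= b1 + b2.
  by move=> h1 h2; rewrite (le_trans (ler_normD _ _))// lerD.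
have tri := Dle _ _ _ _ (Dle _ _ _ _ (Dle _ _ _ _ l6 qD) l5)
  (Dle _ _ _ _ (Dle _ _ _ _ (Dle _ _ _ _ l1 l2) l3) (le_trans l4 l4')).
rewrite /f E.
apply: le_lt_trans tri _.
have -> : 2^-1 * a + e * a + (1 + A) * t * a ^+ 2 +
    (n%:R * (A * a * a) + n%:R * (a * a) + n%:R * (A * a * a) + n%:R ^+ 2 * A * a ^+ 2)
  = 2^-1 * a + e * a + T * a * a by rewrite /T; ring.
have : T * a * a <= T * e * a by rewrite ler_wpM2r ?(ltW a0)// ler_wpM2l ?ltW.
(* Altogether the norm is at most [(1 / 2 + 1 / 8) a], below the [3 / 4 * a] that membership in [C]
   demands. *)
have : e * a + T * e * a = 8^-1 * a.
  have -> : e * a + T * e * a = 8^-1 * (e * (8 * (1 + T))) * a by field.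
  by rewrite eT mulr1.
lra.
Qed.

End VoronoiSpace.

Theorem mainTheorem1 (R : realType) (n : nat) (QQ : set 'M[R]_n)
    (Z : set 'cV[R]_n) (G : set 'M[R]_n) (Q : 'M[R]_n) :
  voronoi_space QQ Z G -> QQ Q ->
  (strictly_extreme QQ Z Q <->
     perfect G Q (Qmin Z Q) /\ eutactic G Q (Qmin Z Q)) /\
  (extreme QQ Z Q <->
     exists X : set 'cV[R]_n,
       [/\ X !=set0, X `<=` Qmin Z Q, weakly_perfect G Q X & eutactic G Q X]).
Proof.
move=> vs QQQ; split; split.
- exact: strictly_extreme_perfect.
- by case; exact: perfect_eutactic_strictly_extreme.
- exact: extreme_weakly_perfect.
by case=> X []; exact: weakly_perfect_eutactic_extreme.
Qed.
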